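(* Let $P\in\mathcal{P}$. If $P$ has order $2n$ (that is, $2n$ vertices) and $n$ is odd, then $P$ contains two disjoint induced even caterpillars whose vertices together span all of $P$ (i.e. the vertex set of $P$ can be partitioned into two subsets each of which induces in $P$ an even caterpillar).
   Context: Graphs are finite and loopless but may have multiple edges. A plane triangulation is a plane graph all of whose faces (including the outer one) are bounded by cycles of length 3. $\mathcal{P}$ is the family of all 2-connected plane triangulations all of whose vertices have degree 3 or 6. A $k$-caterpillar, $k\ge 1$, is a tree $T$ which contains a path $T_0$ (called the spine of $T$) such that $T-V(T_0)$ is a family of independent paths of the same order $k$, i.e. every component of $T-V(T_0)$ is a path with exactly $k$ vertices. Even caterpillars are: all paths, and all $k$-caterpillars with $k$ even. *)

(* Defs.v *)
From mathcomp Require Import all_boot.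
Set Implicit Arguments.
Unset Strict Implicit.
Unset Printing Implicit Defensive.

(* A finite loopless multigraph. Each edge is a pair {d, rev d} of opposite
   darts; d leaves the vertex [src d]. Looplessness makes [rev] fixpoint-free. *)
Record multigraph := Multigraph {
  vertex : finType;
  dart : finType;
  src : dart -> vertex;
  rev : dart -> dart;
  revK : involutive rev;
  loopless : forall d, src (rev d) != src d
}.

Section Multigraph.
Variable G : multigraph.
Implicit Types (x y v : vertex G) (d : dart G) (S : {set vertex G}).
Implicit Types (s : seq (vertex G)) (c : seq (dart G)) (k : nat).

Definition tgt d : vertex G := src (rev d).

Definition edge_mult x y : nat := #|[set d | (src d == x) && (tgt d == y)]|.

Definition degree x : nat := #|[set d | src d == x]|.

Definition adj : rel (vertex G) := [rel x y | 0 < edge_mult x y].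

(* The edges of a cycle are pairwise distinct: two parallel edges form a cycle
   of length 2, but an edge traversed back and forth does not. *)
Definition is_cycle c : bool :=
  [&& c != [::], cycle [rel d d' | tgt d == src d'] c,
      uniq (map (@src G) c) & all (fun d => rev d \notin c) c].

(* The predicates below taking a vertex set S are about the subgraph G[S]
   induced by S, which keeps all parallel edges between vertices of S. *)
Definition adj_in S : rel (vertex G) :=
  [rel x y | [&& x \in S, y \in S & adj x y]].

Definition connected_in S : Prop :=
  S != set0 /\ {in S &, forall x y, connect (adj_in S) x y}.

Definition component_in S x : {set vertex G} :=
  [set y | connect (adj_in S) x y].

Definition acyclic_in S : Prop :=
  forall c, is_cycle c -> ~~ all (fun d => src d \in S) c.

Definition is_tree S : Prop := connected_in S /\ acyclic_in S.

Definition is_path S : Prop :=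
  exists s, [/\ s != [::], uniq s, S = [set x in s] &
    forall x y, x \in s -> y \in s ->
      edge_mult x y = ((index y s == (index x s).+1)
                       || (index x s == (index y s).+1))].

Definition subpath_in S s : bool :=
  [&& s != [::], uniq s & all (mem S) s && sorted adj s].

Definition is_caterpillar k S : Prop :=
  [/\ 0 < k, is_tree S &
    exists2 s, subpath_in S s &
      let R := S :\: [set x in s] in
      forall x, x \in R ->
        is_path (component_in R x) /\ #|component_in R x| = k].

Definition is_even_caterpillar S : Prop :=
  is_path S \/ exists2 k, ~~ odd k & is_caterpillar k S.

Definition two_connected : Prop :=
  [/\ 2 < #|vertex G|, connected_in [set: vertex G] &
      forall v, connected_in [set~ v]].

End Multigraph.

(* A connected plane graph with at least one edge, as a combinatorial map:
   [rot] turns around each vertex, the faces are the orbits of [rot \o rev]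
   (each listing the boundary walk of a face), the edges are the orbits of
   [rev], and genus 0 is Euler's formula #V + #F = #E + 2. *)
Record plane_graph := PlaneGraph {
  graph :> multigraph;
  rot : dart graph -> dart graph;
  rot_inj : injective rot;
  rot_src : forall d d', fconnect rot d d' = (src d == src d');
  plane_connected : connected_in [set: vertex graph];
  plane_euler :
    #|vertex graph| + fcard (rot \o @rev graph) (dart graph)
    = fcard (@rev graph) (dart graph) + 2
}.

Definition face (P : plane_graph) (d : dart P) : dart P := rot (rev d).

Definition is_triangulation (P : plane_graph) : Prop :=
  forall d : dart P,
    is_cycle (orbit (@face P) d) /\ size (orbit (@face P) d) = 3.

Definition in_class_P (P : plane_graph) : Prop :=
  [/\ two_connected P, is_triangulation P &
      forall x : vertex P, degree x = 3 \/ degree x = 6].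

(* Main.v *)
(** The graph [P] is the quotient of the triangular lattice by the group
    generated by the half-turns about the points of a sublattice [L], whose
    classes modulo [2 L] are the four vertices of degree 3: developing [P] along
    straight walks that start at a degree 3 vertex gives the covering, and Euler's
    formula gives a degree 3 vertex to start from. Counting darts, the index of
    [L] is [n - 1], hence even, so that after a rotation all points of [L] lie in
    even rows. In coordinates [X] (doubled) and [Y], let [(0, 2u)] be the vertical
    primitive vector of [L] and let [2q] generate the projection of [L] to the
    horizontal axis. Take for [A] the even rows without the vertical lines
    [X = 0 mod 4q], together with the vertices of the odd rows that are adjacent
    to these lines and satisfy [(X, Y) = (1, 1)] or [(-1, -1) mod (4q, 4)].
    Then [A] induces a path, which snakes through the even rows, whereas the
    complement of [A] induces a caterpillar whose spine zigzags along a vertical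
    line and whose legs lie in the odd rows and have [2q - 2] vertices. *)
From Stdlib Require Import ZArith Lia Classical.
Require Import Defs.
From mathcomp Require Import all_boot all_fingroup cyclic.
From mathcomp Require Import zify.
Set Implicit Arguments.
Unset Strict Implicit.
Unset Printing Implicit Defensive.

Local Notation rev := Defs.rev.
Local Notation revK := Defs.revK.
Local Notation rot := Defs.rot.
Local Notation rot_inj := Defs.rot_inj.

(** * Induced combs *)

Section Combs.
Variable G : multigraph.
Implicit Types (x y : vertex G) (d : dart G) (S : {set vertex G}).

Lemma tgt_rev d : tgt (rev d) = src d.
Proof. by rewrite /tgt Defs.revK. Qed.

Lemma edge_multC x y : edge_mult x y = edge_mult y x.
Proof.
rewrite /edge_mult -(card_imset _ (can_inj (@Defs.revK G))).
apply: eq_card => d; rewrite inE; apply/imsetP/idP => [[d' + ->]|].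
  by rewrite inE tgt_rev andbC.
by move=> dyx; exists (rev d); rewrite ?Defs.revK // inE tgt_rev andbC.
Qed.

Lemma adjE x y : adj x y = (0 < edge_mult x y).
Proof. by []. Qed.

Lemma adj_inE S x y : adj_in S x y = [&& x \in S, y \in S & adj x y].
Proof. by []. Qed.

Lemma adj_in_sym S : symmetric (adj_in S).
Proof. by move=> x y; rewrite !adj_inE !adjE edge_multC andbCA. Qed.

(* A dart of the cycle leaving a vertex of maximal rank and the reverse of the
   dart entering that vertex would be two distinct darts that do not go up. *)
Lemma acyclic_of_rank S (rk : vertex G -> nat) :
    (forall d d', src d = src d' -> src d \in S -> tgt d \in S ->
       tgt d' \in S -> rk (tgt d) <= rk (src d) -> rk (tgt d') <= rk (src d') ->
       d = d') ->
  acyclic_in S.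
Proof.
move=> rkS c /and4P[c0 cyc _ /allP norev]; apply/negP => /allP inS.
have [d0 d0c] : exists d0, d0 \in c.
  by case: c c0 {cyc norev inS} => // d c _; exists d; rewrite mem_head.
case: (@arg_maxnP _ d0 (mem c) (fun d => rk (src d)) d0c) => d dc dmax.
have /eqP tnext := next_cycle cyc dc; have /eqP tprev := prev_cycle cyc dc.
have nc : next c d \in c by rewrite mem_next.
have pc : prev c d \in c by rewrite mem_prev.
suff E : d = rev (prev c d) by case/negP: (norev _ pc); rewrite -E.
have srcE : src (rev (prev c d)) = src d by [].
apply: rkS; rewrite ?tgt_rev ?srcE ?tnext; try exact: inS; try exact: dmax; by [].
Qed.

Section Comb.
Variables (N k : nat) (leg : pred nat) (f : nat -> nat -> vertex G).

(** The vertices [f n 0] with [n <= N] form the spine, and [f n 1], ..., [f n k] is the leg that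
    hangs at [f n 0] when [leg n] holds. *)
Definition comb_index n i := (n <= N) && (i <= if leg n then k else 0).

Definition comb_edge n i n' i' :=
  ((n == n') && ((i' == i.+1) || (i == i'.+1))) ||
  [&& i == 0, i' == 0 & (n' == n.+1) || (n == n'.+1)].

Hypothesis f_inj : forall n i n' i', comb_index n i -> comb_index n' i' ->
  f n i = f n' i' -> n = n' /\ i = i'.
Hypothesis f_edge : forall n i n' i', comb_index n i -> comb_index n' i' ->
  edge_mult (f n i) (f n' i') = comb_edge n i n' i'.
Variable S : {set vertex G}.
Hypothesis f_mem : forall n i, comb_index n i -> f n i \in S.
Hypothesis memS : forall x, x \in S -> exists n i, comb_index n i /\ x = f n i.

Lemma comb_index0 n : n <= N -> comb_index n 0.
Proof. by rewrite /comb_index => ->. Qed.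

Lemma comb_indexW n i i' : i' <= i -> comb_index n i -> comb_index n i'.
Proof. by rewrite /comb_index => le_i /andP[-> /(leq_trans le_i)]. Qed.

Lemma comb_index_bounds n i : comb_index n i -> n <= N /\ i <= k.
Proof. by case/andP=> nN; case: ifP => // _; case: i. Qed.

Definition comb_spine := [seq f n 0 | n <- iota 0 N.+1].

Lemma mem_comb_spine n i : comb_index n i -> (f n i \in comb_spine) = (i == 0).
Proof.
move=> ni; apply/mapP/eqP => [[m]|->]; last first.
  by exists n => //; rewrite mem_iota; have [] := comb_index_bounds ni; lia.
rewrite mem_iota => mN; have m0 : comb_index m 0 by apply: comb_index0; lia.
by case/(f_inj ni m0).
Qed.

Lemma uniq_comb_spine : uniq comb_spine.
Proof.
rewrite map_inj_in_uniq ?iota_uniq // => n m; rewrite !mem_iota => nN mN.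
by case/f_inj => //; apply: comb_index0; lia.
Qed.

Lemma nth_comb_spine n x : n <= N -> nth x comb_spine n = f n 0.
Proof. by move=> nN; rewrite (nth_map 0) ?size_iota // nth_iota. Qed.

Lemma index_comb_spine n : n <= N -> index (f n 0) comb_spine = n.
Proof.
move=> nN; rewrite -{1}(nth_comb_spine (f n 0) nN) index_uniq ?uniq_comb_spine //.
by rewrite size_map size_iota.
Qed.

Lemma comb_path : k = 0 -> is_path S.
Proof.
move=> k0; have i0 n i : comb_index n i -> i = 0.
  by case/comb_index_bounds; lia.
exists comb_spine; split; rewrite ?uniq_comb_spine //.
  apply/setP=> x; rewrite inE; apply/idP/mapP=> [/memS[n [i [ni ->]]]|[n]].
    exists n; last by rewrite (i0 _ _ ni).
    by rewrite mem_iota; case/comb_index_bounds: ni; lia.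
  by rewrite mem_iota => nN ->; apply/f_mem/comb_index0; lia.
move=> x y /mapP[n + ->] /mapP[m + ->]; rewrite !mem_iota => nN mN.
have [nN' mN'] : n <= N /\ m <= N by lia.
rewrite !index_comb_spine // f_edge ?comb_index0 // /comb_edge /=.
by rewrite andbF.
Qed.

Lemma comb_adj n i n' i' : comb_index n i -> comb_index n' i' ->
  adj (f n i) (f n' i') = comb_edge n i n' i'.
Proof. by move=> ni ni'; rewrite adjE f_edge // lt0b. Qed.

Lemma comb_adj_in n i n' i' : comb_index n i -> comb_index n' i' ->
  adj_in S (f n i) (f n' i') = comb_edge n i n' i'.
Proof. by move=> ni ni'; rewrite -comb_adj // adj_inE !f_mem. Qed.

Lemma comb_connected : connected_in S.
Proof.
split; first by apply/set0Pn; exists (f 0 0); apply/f_mem/comb_index0.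
suff to0 x : x \in S -> connect (adj_in S) (f 0 0) x.
  move=> x y xS yS; apply: connect_trans (to0 _ yS).
  by rewrite (sym_connect_sym (@adj_in_sym S)) to0.
case/memS=> n [i [ni ->]].
apply: (@connect_trans _ _ (f n 0)).
  have [+ _] := comb_index_bounds ni; elim: n {ni} => // n IHn nN.
  apply: connect_trans (IHn (ltnW nN)) (connect1 _).
  rewrite comb_adj_in ?comb_index0 //; last exact: ltnW.
  by rewrite /comb_edge; lia.
elim: i ni => // i IHi ni; have ni' := comb_indexW (leqnSn i) ni.
apply: connect_trans (IHi ni') (connect1 _).
by rewrite comb_adj_in // /comb_edge; lia.
Qed.

(* The rank lists the spine first and then the vertices of the legs by their
   distance to the spine. *)
Lemma comb_acyclic : acyclic_in S.
Proof.
pose good x (p : 'I_N.+1 * 'I_k.+1) :=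
  comb_index p.1 p.2 && (f p.1 p.2 == x).
pose rk x := if [pick p | good x p] is Some p then p.1 + p.2 * N.+1 else 0.
have rkE n i : comb_index n i -> rk (f n i) = n + i * N.+1.
  move=> ni; rewrite /rk; case: pickP => [[a b] /andP[/= ab]|].
    by move/eqP=> /(f_inj ab ni)[-> ->].
  have [nN ik] := comb_index_bounds ni.
  by move/(_ (Ordinal (nN : n < N.+1), Ordinal (ik : i < k.+1)));
     rewrite /good /= ni eqxx.
have lower n i n' i' : comb_index n i -> comb_index n' i' ->
    adj (f n i) (f n' i') -> rk (f n' i') <= rk (f n i) ->
    if i is j.+1 then n' = n /\ i' = j else n = n'.+1 /\ i' = 0.
  move=> ni ni'; have [nN _] := comb_index_bounds ni.
  have [nN' _] := comb_index_bounds ni'.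
  rewrite comb_adj // !rkE // /comb_edge.
  by case: i {ni} => [|i]; case: i' {ni'} => [|i']; nia.
apply: (acyclic_of_rank (rk := rk)) => d d' eq_src dS tS t'S le_d le_d'.
have adj_d (e : dart G) : adj (src e) (tgt e).
  by rewrite adjE card_gt0; apply/set0Pn; exists e; rewrite inE !eqxx.
have [n [i [ni dE]]] := memS dS.
have [n1 [i1 [ni1 tE]]] := memS tS; have [n2 [i2 [ni2 t'E]]] := memS t'S.
have d'E : src d' = f n i by rewrite -eq_src.
have := adj_d d; rewrite dE tE => adj1.
have := adj_d d'; rewrite d'E t'E => adj2.
rewrite dE tE in le_d; rewrite d'E t'E in le_d'.
have := lower _ _ _ _ ni ni1 adj1 le_d; have := lower _ _ _ _ ni ni2 adj2 le_d'.
move=> low2 low1.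
have [en ei] : n2 = n1 /\ i2 = i1 by case: (i) low1 low2; lia.
have : edge_mult (src d) (tgt d) <= 1 by rewrite dE tE f_edge // leq_b1.
move/card_le1_eqP; apply; rewrite inE ?eqxx // -eq_src eqxx /=.
by rewrite t'E tE en ei.
Qed.

(** An edge that avoids the spine cannot change [n], so a walk off the spine stays within one
    leg. *)
Lemma comb_component n i : comb_index n i -> 0 < i ->
  component_in (S :\: [set x in comb_spine]) (f n i)
  = [set x in [seq f n j | j <- iota 1 k]].
Proof.
set R := S :\: _ => ni i_gt0.
have [nN ik] := comb_index_bounds ni.
have leg_n j : j <= k -> comb_index n j.
  by move=> jk; move: ni; rewrite /comb_index nN; case: ifP => //; lia.
have memR m j : comb_index m j -> (f m j \in R) = (0 < j).
  by move=> mj; rewrite in_setD in_set mem_comb_spine // f_mem // andbT lt0n.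
apply/setP=> x; rewrite !inE; apply/idP/mapP => [/connectP[p + ->]|[j + ->]].
  elim: p (i) ni i_gt0 => [|y p IHp] i1 ni1 i1_gt0 /=.
    by exists i1; rewrite // mem_iota; case/comb_index_bounds: ni1; lia.
  case/andP; rewrite adj_inE => /and3P[_ yR]; have [m [j [mj yE]]] :=
    memS (subsetP (subsetDl _ _) _ yR).
  have := yR; rewrite yE memR // => j_gt0; rewrite comb_adj //.
  rewrite /comb_edge => edge; have nm : m = n by lia.
  by rewrite nm in mj *; apply: IHp.
rewrite mem_iota => /andP[j_gt0 jk].
have up j0 : 0 < j0 <= k -> connect (adj_in R) (f n 1) (f n j0).
  elim: j0 => // -[|j0] IHj /andP[_ jk0] //.
  apply: connect_trans (IHj _) (connect1 _); first by lia.
  rewrite adj_inE !memR ?leg_n //; try lia.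
  by rewrite [X in _ && (_ && X)]comb_adj ?leg_n // /comb_edge; lia.
apply: connect_trans (up j _); last by lia.
by rewrite (sym_connect_sym (@adj_in_sym R)) up // i_gt0.
Qed.

Lemma comb_leg_path n i : comb_index n i -> 0 < i ->
  let C := component_in (S :\: [set x in comb_spine]) (f n i) in
  is_path C /\ #|C| = k.
Proof.
move=> ni i_gt0 C; rewrite {}/C comb_component //.
have [nN ik] := comb_index_bounds ni.
have leg_n j : j <= k -> comb_index n j.
  by move=> jk; move: ni; rewrite /comb_index nN; case: ifP => //; lia.
set s := map _ _.
have s_uniq : uniq s.
  rewrite map_inj_in_uniq ?iota_uniq // => a b; rewrite !mem_iota => ak bk.
  by case/f_inj => //; apply: leg_n; lia.
have s_size : size s = k by rewrite size_map size_iota.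
split; last by rewrite cardsE (card_uniqP s_uniq).
exists s; split=> //; first by rewrite -size_eq0 s_size; lia.
have s_index a : 0 < a <= k -> index (f n a) s = a.-1.
  move=> ak; have -> : f n a = nth (f n a) s a.-1.
    rewrite (nth_map 0) ?size_iota; last by lia.
    by rewrite nth_iota; [congr f; lia | lia].
  by rewrite index_uniq // s_size; lia.
move=> x y /mapP[a + ->] /mapP[b + ->]; rewrite !mem_iota => ak bk.
rewrite !s_index; try lia.
rewrite f_edge; [|apply: leg_n; lia..].
by congr nat_of_bool; rewrite /comb_edge; lia.
Qed.

(** A caterpillar requires [0 < k], so the case [k = 0] is treated apart: the comb then reduces to
    its spine and is a path. *)
Lemma comb_even_caterpillar : ~~ odd k -> is_even_caterpillar S.
Proof.
move=> k_even; have [/comb_path|k_gt0] := posnP k; first by left.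
right; exists k => //; split=> //.
  by split; [exact: comb_connected | exact: comb_acyclic].
exists comb_spine.
  rewrite /subpath_in uniq_comb_spine; apply/and3P; split=> //; apply/andP; split.
    apply/allP=> x /mapP[n]; rewrite mem_iota => nN ->.
    by apply/f_mem/comb_index0; lia.
  apply/(pathP (f 0 0)) => i; rewrite size_map size_iota => iN.
  rewrite -/(iota 0 N.+1); have := @nth_comb_spine i (f 0 0) (ltnW iN).
  have := @nth_comb_spine i.+1 (f 0 0) iN; rewrite /comb_spine /= => -> ->.
  by rewrite comb_adj ?comb_index0 ?(ltnW iN) // /comb_edge; lia.
move=> R x; rewrite in_setD in_set => /andP[xs xS].
have [n [i [ni xE]]] := memS xS.
move: xs; rewrite xE mem_comb_spine // => i_gt0.
by apply: comb_leg_path => //; rewrite lt0n.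
Qed.

End Comb.
End Combs.

(** * Integer powers and the symmetries of the triangular lattice *)

Section ZPowers.
Local Open Scope group_scope.
Variable gT : finGroupType.
Implicit Types (g h : gT) (a b : Z).

(** Integer exponents let the coordinates of translations range over [Z]. *)
Definition zexpg g a : gT :=
  match a with
  | Z0 => 1
  | Zpos p => g ^+ Pos.to_nat p
  | Zneg p => g ^- Pos.to_nat p
  end.

Lemma zexpg_nat g n : zexpg g (Z.of_nat n) = g ^+ n.
Proof. by case: n => // n; rewrite /= SuccNat2Pos.id_succ. Qed.

Lemma zexpgNnat g n : zexpg g (- Z.of_nat n)%Z = g ^- n.
Proof. by case: n => [|n]; rewrite /= ?invg1 // SuccNat2Pos.id_succ. Qed.

Lemma zexpgS g a : zexpg g (a + 1)%Z = zexpg g a * g.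
Proof.
have [a_ge0|a_lt0] := Z_le_gt_dec 0 a.
  have -> : a = Z.of_nat (Z.to_nat a) by lia.
  have -> n : (Z.of_nat n + 1 = Z.of_nat n.+1)%Z by lia.
  by rewrite !zexpg_nat expgSr.
have -> : a = (- Z.of_nat (Z.to_nat (- a - 1)).+1)%Z by lia.
set n := Z.to_nat _.
have -> : (- Z.of_nat n.+1 + 1 = - Z.of_nat n)%Z by lia.
by rewrite !zexpgNnat expgS invMg mulgKV.
Qed.

Lemma zexpgD g a b : zexpg g (a + b)%Z = zexpg g a * zexpg g b.
Proof.
elim/Z.peano_ind: b => [|b IHb|b IHb]; first by rewrite Z.add_0_r mulg1.
  have -> : (a + Z.succ b = (a + b) + 1)%Z by lia.
  by rewrite -Z.add_1_r !zexpgS IHb mulgA.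
apply: (mulIg g); rewrite -mulgA -!zexpgS.
have -> : (a + Z.pred b + 1 = a + b)%Z by lia.
by have -> : (Z.pred b + 1 = b)%Z by lia.
Qed.

Lemma zexpg_commute g h a b :
  commute g h -> commute (zexpg g a) (zexpg h b).
Proof.
have aux x y n : commute x y -> commute x (zexpg y n).
  move=> xy; case: n => [|p|p] /=; first exact: commute1.
    exact: commuteX.
  exact/commuteV/commuteX.
by move=> gh; apply/aux/commute_sym/aux/commute_sym.
Qed.

Lemma zexpgVn g a : zexpg g^-1 a = zexpg g (- a)%Z.
Proof. by case: a => [|p|p] //=; rewrite expVgn ?invgK. Qed.

Lemma zexpgJ g h a : zexpg (g * h * g^-1) a = g * zexpg h a * g^-1.
Proof.
have conjE x : g * x * g^-1 = x ^ g^-1 by rewrite conjgE invgK mulgA.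
by rewrite !conjE; case: a => [|p|p] /=; rewrite ?conj1g ?conjVg ?conjXg.
Qed.

Lemma zexpgMn g h a :
  commute g h -> zexpg (g * h) a = zexpg g a * zexpg h a.
Proof.
case: a => [|p|p] /= gh; rewrite ?mulg1 ?expgMn // invMg.
exact/esym/commuteV/commute_sym/commuteV/commuteX2/commute_sym.
Qed.

End ZPowers.

(* The group of orientation preserving symmetries of the triangular lattice:
   [r] turns by 60 degrees around a vertex, [s] by 180 degrees around the
   midpoint of an edge. The translations [hexT k] along the six directions are
   written in the basis [hexT 0], [hexT 1]. *)
Section HexagonalGroup.
Local Open Scope group_scope.
Variables (gT : finGroupType) (r s : gT).
Hypotheses (r6 : r ^+ 6 = 1) (s2 : s * s = 1) (sr3 : (s * r) ^+ 3 = 1).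

(* [expgS] and [expgD] with the canonical instances of [gT], so that the result
   can be rewritten further by the lemmas on groups. *)
Lemma expgSE (g : gT) n : g ^+ n.+1 = g * g ^+ n.
Proof. exact: expgS. Qed.

Lemma expgDE (g : gT) m n : g ^+ (m + n) = g ^+ m * g ^+ n.
Proof. exact: expgD. Qed.

(** The half-turns about the midpoint of an edge and about an end of it compose to a translation;
    conjugation by [r ^+ k] turns its direction. *)
Definition hexT k := r ^+ k * (s * r ^+ 3) * r ^- k.

Lemma hexVs : s^-1 = s.
Proof. by apply/eqP; rewrite eq_invg_mul s2. Qed.

Lemma hexVr : r^-1 = r ^+ 5.
Proof. by apply/eqP; rewrite eq_invg_mul -expgSE r6. Qed.

Lemma hex_srs : s * r * s = r^-1 * s * r^-1.
Proof.
apply: (mulgI r); apply: (mulIg r); rewrite !mulgA mulgV mul1g mulgKV.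
by apply: (mulgI s); rewrite s2 -sr3 !expgSE expg0 mulg1 !mulgA.
Qed.

Lemma hex_sVrs : s * r^-1 * s = r * s * r.
Proof.
by apply: invg_inj; rewrite !invMg invgK hexVs mulgA hex_srs mulgA.
Qed.

Lemma hexTS k : r * hexT k * r^-1 = hexT k.+1.
Proof. by rewrite /hexT (expgSE r k) invMg !mulgA. Qed.

Lemma hexT0E : hexT 0 = s * r * r * r.
Proof. by rewrite /hexT expg0 invg1 mulg1 mul1g !expgSE expg0 mulg1 !mulgA. Qed.

Lemma hexT1E : hexT 1 = r * s * r * r.
Proof. by rewrite -hexTS hexT0E !mulgA mulgK. Qed.

Lemma hexT2E : hexT 2 = r * r * s * r.
Proof. by rewrite -hexTS hexT1E !mulgA mulgK. Qed.

Lemma hexVrE : r * r * r * r * r = r^-1.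
Proof. by rewrite hexVr !expgSE expg0 mulg1 !mulgA. Qed.

(** Together with [hexT20], which computes the product in the other order, this yields the
    commutation of the translations. *)
Lemma hexT02 : hexT 0 * hexT 2 = hexT 1.
Proof.
rewrite hexT0E hexT1E hexT2E.
have -> : s * r * r * r * (r * r * s * r) = s * (r * r * r * r * r) * s * r.
  by rewrite !mulgA.
by rewrite hexVrE hex_sVrs.
Qed.

Lemma hexT20 : hexT 2 * hexT 0 = hexT 1.
Proof.
rewrite hexT0E hexT1E hexT2E.
have -> : r * r * s * r * (s * r * r * r) = r * r * (s * r * s) * r * r * r.
  by rewrite !mulgA.
by rewrite hex_srs !mulgA mulgK mulgKV.
Qed.

Lemma hexT_commute02 : commute (hexT 0) (hexT 2).
Proof. by rewrite /commute hexT02 hexT20. Qed.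

Lemma hexT_commute01 : commute (hexT 0) (hexT 1).
Proof. by rewrite -hexT02; apply: commuteM => //; apply: hexT_commute02. Qed.

Lemma hexT3 k : hexT (k + 3) = (hexT k)^-1.
Proof.
elim: k => [|k IHk].
  rewrite add0n -hexTS hexT2E hexT0E !mulgA mulgK.
  apply/eqP; rewrite eq_sym eq_invg_mul.
  have -> : s * r * r * r * (r * r * r * s) = s * ((r * r * r * r * r) * r) * s.
    by rewrite !mulgA.
  by rewrite hexVrE mulVg mulg1 s2.
by rewrite addSn -hexTS IHk -(hexTS k) (invMg (r * hexT k)) invgK (invMg r (hexT k)) mulgA.
Qed.

(** Geometrically, reversing a dart of direction [k] moves to the neighbour in that direction and
    turns the dart by 180 degrees. *)
Lemma hexT_rev k : r ^+ k * s = hexT k * r ^+ (k + 3).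
Proof.
have r33 : r ^+ 3 * r ^+ 3 = 1 by rewrite -expgDE.
by rewrite /hexT expgDE; move: (r ^+ 3) r33 => x xx;
  rewrite -!mulgA mulKg xx mulg1.
Qed.

(* The components, in the basis [hexT 0], [hexT 1], of the [k]-th direction. *)
Definition hex_dx k : Z := nth 0%Z [:: 1; 0; -1; -1; 0; 1]%Z (k %% 6).
Definition hex_dy k : Z := nth 0%Z [:: 0; 1; 1; 0; -1; -1]%Z (k %% 6).

Lemma hex_dE :
  ((hex_dx 0 = 1%Z) * (hex_dx 1 = 0%Z) * (hex_dx 2 = (-1)%Z) *
   (hex_dx 3 = (-1)%Z) * (hex_dx 4 = 0%Z) * (hex_dx 5 = 1%Z) *
   (hex_dy 0 = 0%Z) * (hex_dy 1 = 1%Z) * (hex_dy 2 = 1%Z) *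
   (hex_dy 3 = 0%Z) * (hex_dy 4 = (-1)%Z) * (hex_dy 5 = (-1)%Z))%type.
Proof. by []. Qed.

Definition hexTT i j := zexpg (hexT 0) i * zexpg (hexT 1) j.

Lemma hexTTD i j i' j' : hexTT i j * hexTT i' j' = hexTT (i + i') (j + j').
Proof.
rewrite /hexTT !zexpgD -!mulgA; congr (_ * _); rewrite !mulgA; congr (_ * _).
by apply/commute_sym/zexpg_commute/hexT_commute01.
Qed.

Lemma hexT_mod k : hexT (k %% 6) = hexT k.
Proof.
have aux a : r ^+ (a %% 6) = r ^+ a.
  rewrite [in RHS](divn_eq a 6) expgDE mulnC expgM r6 expg1n.
  by rewrite mul1g.
by rewrite /hexT aux.
Qed.

Lemma hexTTE k : hexTT (hex_dx k) (hex_dy k) = hexT k.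
Proof.
have T2 : hexT 2 = (hexT 0)^-1 * hexT 1 by rewrite -hexT02 mulKg.
rewrite -(hexT_mod k) /hexTT /hex_dx /hex_dy.
have := ltn_pmod k (isT : 0 < 6).
case: (k %% 6) => [|[|[|[|[|[|//]]]]]] _ /=; rewrite ?mulg1 ?mul1g ?expg1 //.
- by rewrite -(hexT3 0).
- by rewrite -(hexT3 1).
by rewrite (hexT3 2) T2 (invMg (hexT 0)^-1) invgK; apply:
  (commuteV hexT_commute01).
Qed.

(** The turn by 60 degrees sends [hexT 0] to [hexT 1], and [hexT 1] to [hexT 2], which is
    [(hexT 0)^-1 * hexT 1]. *)
Lemma hexTTS i j : r * hexTT i j * r^-1 = hexTT (- j) (i + j).
Proof.
have T2 : hexT 2 = (hexT 0)^-1 * hexT 1 by rewrite -hexT02 mulKg.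
have -> : r * hexTT i j * r^-1 = zexpg (hexT 1) i * zexpg (hexT 2) j.
  rewrite -(hexTS 0) -(hexTS 1) (zexpgJ r (hexT 0)) (zexpgJ r (hexT 1)).
  by rewrite /hexTT !mulgA mulgKV.
have VT01 : commute (hexT 0)^-1 (hexT 1).
  exact/commute_sym/commuteV/commute_sym/hexT_commute01.
rewrite T2 (zexpgMn _ VT01) zexpgVn /hexTT zexpgD mulgA.
rewrite [_ * zexpg (hexT 0) _]zexpg_commute ?mulgA //.
exact/commute_sym/hexT_commute01.
Qed.

Lemma hexTT3 i j : r ^+ 3 * hexTT i j = hexTT (- i) (- j) * r ^+ 3.
Proof.
have aux i' j' : r * hexTT i' j' = hexTT (- j') (i' + j') * r.
  by rewrite -hexTTS mulgKV.
have r3l x : r ^+ 3 * x = r * (r * (r * x)).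
  by rewrite !expgSE expg0 mulg1 -!mulgA.
have r3r x : x * r ^+ 3 = x * r * r * r by rewrite !expgSE expg0 mulg1 !mulgA.
rewrite r3l r3r aux (mulgA r (hexTT _ _)) aux (mulgA r) (mulgA r) aux.
by congr (hexTT _ _ * _ * _ * _); lia.
Qed.

End HexagonalGroup.

(** * The covering by the triangular lattice *)

Section Triangulation.
Variable P : plane_graph.
Hypothesis tri : is_triangulation P.
Hypothesis deg36 : forall x : vertex P, degree x = 3 \/ degree x = 6.
Implicit Types (d : dart P) (i j : Z) (k : nat).

Lemma order_rot d : fingraph.order (@rot P) d = degree (src d).
Proof.
by apply: eq_card => d'; rewrite inE [LHS]rot_src eq_sym.
Qed.

Definition rot_perm := perm (@rot_inj P).
Definition rev_perm := perm (can_inj (@revK P)).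

Local Notation r := rot_perm.
Local Notation s := rev_perm.

Lemma rot_permX k d : (r ^+ k)%g d = iter k (@rot P) d.
Proof. by rewrite permX; apply: eq_iter => x; rewrite permE. Qed.

(** Both degrees 3 and 6 divide 6. With [rev_perm2] and [face_perm3], the symmetry group of the
    triangular lattice thus acts on the darts of [P]. *)
Lemma rot_perm6 : (r ^+ 6 = 1)%g.
Proof.
apply/permP=> d; rewrite rot_permX perm1.
have := iter_order (@rot_inj P) d; rewrite order_rot.
by case: (deg36 (src d)) => -> // h3; rewrite -[6]/(3 + 3) iterD !h3.
Qed.

Lemma rev_perm2 : (s * s = 1)%g.
Proof. by apply/permP=> d; rewrite permM !permE revK. Qed.

Lemma face_perm3 : ((s * r) ^+ 3 = 1)%g.
Proof.
apply/permP=> d; rewrite permX perm1.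
have [_ face3] := tri d; rewrite size_orbit in face3.
have face_inj : injective (@face P).
  exact: inj_comp (@rot_inj P) (can_inj (@revK P)).
rewrite -[RHS](iter_order face_inj) face3.
by apply: eq_iter => x; rewrite permM !permE.
Qed.

Lemma rot_neq d : rot d != d.
Proof.
apply/eqP=> rd; have := orbit_uniq (@rot P) d.
by rewrite /fingraph.orbit order_rot; case: (deg36 (src d)) => -> /=;
  rewrite rd inE eqxx.
Qed.

Lemma rev_neq d : rev d != d.
Proof. by apply: contraNneq (loopless d) => ->. Qed.

(** Each face consists of 3 darts and each edge of 2, so Euler's formula becomes a relation between
    vertices and darts only. *)
Lemma euler_count : #|dart P| + 12 = 6 * #|vertex P|.
Proof.
have face_inj : injective (@face P).
  exact: inj_comp (@rot_inj P) (can_inj (@revK P)).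
have F : fcard (@rot P \o @rev P) (dart P) * 3 = #|dart P|.
  apply: (@fcard_order_set _ _ face_inj 3) => //.
  by apply/subsetP=> d _; rewrite inE -size_orbit; have [_ ->] := tri d.
have E : fcard (@rev P) (dart P) * 2 = #|dart P|.
  apply: (fcard_order_set (can_inj (@revK P))) => //.
  apply/subsetP=> d _; rewrite inE; apply/eqP.
  apply: (@order_cycle _ _ [:: d; rev d]); rewrite /= ?revK ?eqxx ?inE //.
    by rewrite eq_sym rev_neq.
  by rewrite eqxx.
by have := plane_euler P; lia.
Qed.

Lemma card_dart_degree : #|dart P| = \sum_(x : vertex P) degree x.
Proof.
rewrite -sum1_card (partition_big (@src P) predT) //=.
by apply: eq_bigr => x _; rewrite sum1dep_card.
Qed.

(** If all degrees were 6, there would be [6 * #|vertex P|] darts, against [euler_count]. *)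
Lemma degree3_exists : exists d, degree (src d) = 3.
Proof.
have [x x3|all6] := pickP [pred x : vertex P | degree x == 3].
  have : 0 < degree x by rewrite (eqP x3).
  rewrite card_gt0 => /set0Pn[d]; rewrite inE => /eqP dx.
  by exists d; rewrite dx (eqP x3).
have := euler_count; rewrite card_dart_degree (eq_bigr (fun=> 6)).
  by rewrite sum_nat_const (_ : #|xpredT| = #|vertex P|); [lia | apply: eq_card].
by move=> x _; case: (deg36 x) => // x3; have := all6 x; rewrite /= x3.
Qed.

(** * Development of the lattice onto [P] from a base dart *)

Variable d0 : dart P.

(** The image in [P] of the lattice dart at [(i, j)] in direction [k] modulo 6. Permutations compose
    from left to right, so the translation acts before the rotation. At a vertex of degree 3 the six
    directions run twice through the darts. *)
Definition hex_dart k i j : dart P := (hexTT r s i j * r ^+ k)%g d0.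
Definition hex_vertex i j : vertex P := src (hex_dart 0 i j).

Local Notation e := hex_dart.
Local Notation V := hex_vertex.

Let T_rot i j : (r * hexTT r s i j = hexTT r s (- j) (i + j) * r)%g.
Proof.
by rewrite -(hexTTS rot_perm6 rev_perm2 face_perm3) mulgKV.
Qed.

Let T_rot3 i j : (r ^+ 3 * hexTT r s i j = hexTT r s (- i) (- j) * r ^+ 3)%g.
Proof. exact: hexTT3 rot_perm6 rev_perm2 face_perm3 i j. Qed.

Let TD i j i' j' :
  (hexTT r s i j * hexTT r s i' j' = hexTT r s (i + i') (j + j'))%g.
Proof. exact: hexTTD rot_perm6 rev_perm2 face_perm3 i j i' j'. Qed.

Lemma hex_dart0 : e 0 0 0 = d0.
Proof. by rewrite /e /hexTT /= !mulg1 perm1. Qed.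

Lemma iter_rot_hex_dart m k i j : iter m (@rot P) (e k i j) = e (k + m) i j.
Proof. by rewrite -rot_permX /e expgDE mulgA [RHS]permM. Qed.

Lemma rot_hex_dart k i j : rot (e k i j) = e k.+1 i j.
Proof. by rewrite -addn1 -iter_rot_hex_dart. Qed.

Lemma hex_dart_mod k i j : e (k %% 6) i j = e k i j.
Proof.
rewrite /e [in RHS](divn_eq k 6) addnC (expgDE r) mulnC.
have -> n : (r ^+ (6 * n) = 1)%g.
  by elim: n => // n IHn; rewrite mulnS expgDE IHn rot_perm6 mulg1.
by rewrite mulg1.
Qed.

Lemma rev_hex_dart k i j :
  rev (e k i j) = e (k + 3) (i + hex_dx k) (j + hex_dy k).
Proof.
have -> : rev (e k i j) = s (e k i j) by rewrite permE.
rewrite /e -permM -mulgA (@hexT_rev _ r s rot_perm6).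
by rewrite -(hexTTE rot_perm6 rev_perm2 face_perm3) mulgA TD.
Qed.

Lemma src_hex_dart k i j : src (e k i j) = V i j.
Proof.
by apply/eqP; rewrite eq_sym -rot_src -(iter_rot_hex_dart k 0) fconnect_iter.
Qed.

Lemma tgt_hex_dart k i j : tgt (e k i j) = V (i + hex_dx k) (j + hex_dy k).
Proof. by rewrite /tgt rev_hex_dart src_hex_dart. Qed.

Lemma src_hex_vertex d i j : src d = V i j -> exists2 k, k < 6 & d = e k i j.
Proof.
move=> dE; have : fconnect (@rot P) (e 0 i j) d by rewrite rot_src dE.
move/iter_findex=> <-; set m := findex _ _ _.
exists (m %% 6); first by rewrite ltn_pmod.
by rewrite hex_dart_mod iter_rot_hex_dart.
Qed.

Lemma hex_vertex_surj x : exists i j, x = V i j.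
Proof.
have [_ /(_ (src d0) x) conn] := plane_connected P.
have /connectP[p + ->] := conn (in_setT _) (in_setT _).
have [i [j ->]] : exists i j, src d0 = V i j.
  by exists 0%Z, 0%Z; rewrite /V hex_dart0.
elim: p i j => [|y p IHp] i j /=; first by exists i, j.
case/andP; rewrite adj_inE adjE card_gt0 => /and3P[_ _ /set0Pn[d +]].
rewrite inE => /andP[/eqP/src_hex_vertex[k _ ->] /eqP <-].
by rewrite tgt_hex_dart => /IHp.
Qed.

Lemma hex_dart_surj d : exists k i j, k < 6 /\ d = e k i j.
Proof.
have [i [j /src_hex_vertex[k k6 ->]]] := hex_vertex_surj (src d).
by exists k, i, j.
Qed.

(** By [hex_dart_eq], these translations account for all coincidences between images of lattice
    darts of the same direction. *)
Definition hex_period i j := e 0 i j = d0.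
Local Notation L := hex_period.

Lemma hex_dart_eq k i j i' j' : e k i j = e k i' j' <-> L (i - i') (j - j').
Proof.
have kE a b : e k a b = (r ^+ k)%g (e 0 a b).
  by rewrite rot_permX iter_rot_hex_dart.
have e0E : e 0 i j = (hexTT r s i' j') (e 0 (i - i') (j - j')).
  by rewrite /e !mulg1 -permM TD !Z.sub_add.
have e0E' : e 0 i' j' = (hexTT r s i' j') d0 by rewrite /e mulg1.
rewrite !kE e0E e0E'; split=> [/perm_inj/perm_inj //|].
by rewrite /hex_period => ->.
Qed.

Lemma hex_period0 : L 0 0. Proof. exact: hex_dart0. Qed.

Lemma hex_periodB i j i' j' : L i j -> L i' j' -> L (i - i') (j - j').
Proof. by move=> Lij Lij'; apply/(hex_dart_eq 0); rewrite Lij. Qed.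

(** The order of the finite group of permutations of the darts serves as [N]. *)
Lemma hex_period_bound : exists2 N : Z, (0 < N)%Z & L N 0 /\ L 0 N.
Proof.
pose N := #|{perm (dart P)}|.
have TN (g : {perm (dart P)}) : zexpg g (Z.of_nat N) = 1%g.
  by rewrite zexpg_nat /N -cardsT expg_cardG ?inE.
exists (Z.of_nat N); last by rewrite /L /e /hexTT !TN /= !mulg1 perm1.
have : 0 < N by apply/card_gt0P; exists 1%g.
by lia.
Qed.

Lemma hex_dart_shift i j i' j' a b : e 1 i j = e 0 i' j' ->
  e 1 (i - b) (j + (a + b)) = e 0 (i' + a) (j' + b).
Proof.
move/(congr1 (hexTT r s a b)); rewrite /e -!permM mulg1 expg1 mulg1.
by rewrite -mulgA T_rot mulgA !TD.
Qed.

(** A turn by 60 degrees composed with a translation is a turn about some lattice point. The shift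
    of [hex_dart_shift] moves both darts to this centre, where the equality would say that [rot]
    fixes a dart. *)
Lemma hex_dart10_neq i j i' j' : e 1 i j <> e 0 i' j'.
Proof.
move/(hex_dart_shift (j' - j) (i - i' - (j' - j))) => e10.
have := rot_neq (e 0 (i' + (j' - j)) (j' + (i - i' - (j' - j)))).
rewrite rot_hex_dart -[X in _ != X]e10; case/eqP.
by congr (e _ _ _); lia.
Qed.

(** * Half-turns about the vertices of degree 3 *)

Hypothesis cone0 : degree (src d0) = 3.

(** The permutation [r ^+ 3] fixes [d0], and passing it through a translation negates the
    coordinates: the half-turn about the origin does not change images in [P]. *)
Lemma hex_dart_opp k i j : e (k + 3) i j = e k (- i) (- j).
Proof.
have r3 : (r ^+ 3)%g d0 = d0.
  rewrite rot_permX; have := iter_order (@rot_inj P) d0.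
  by rewrite order_rot cone0.
have : (hexTT r s i j * r ^+ 3 = r ^+ 3 * hexTT r s (- i) (- j))%g.
  by rewrite T_rot3 !Z.opp_involutive.
rewrite addnC /e expgDE; move: (r ^+ 3)%g r3 => x xd0 Tx.
by rewrite mulgA Tx -mulgA permM xd0.
Qed.

(** Two lattice darts with the same image differ by a turn of [k] sixths. The values 0 and 3 give
    the two alternatives, and [hex_dart_opp] reduces the others to [hex_dart10_neq]. *)
Lemma hex_vertex_eq i j i' j' :
  V i j = V i' j' <-> L (i - i') (j - j') \/ L (i + i') (j + j').
Proof.
have e0E a b : e 0 a b = e 3 (- a) (- b).
  by rewrite (hex_dart_opp 0) !Z.opp_involutive.
have Lsum : L (i + i') (j + j') <-> e 0 i j = e 0 (- i') (- j').
  by rewrite hex_dart_eq !Z.sub_opp_r.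
rewrite -(hex_dart_eq 0) Lsum; split=> [|[]]; last 2 first.
- by rewrite /V => ->.
- by rewrite /V => ->; rewrite -(hex_dart_opp 0) src_hex_dart.
case/src_hex_vertex=> k k6 kE.
have {kE} kE m : e m i j = e (k + m) i' j'.
  by rewrite -iter_rot_hex_dart -kE iter_rot_hex_dart.
have e6 a b : e 6 a b = e 0 a b by rewrite -hex_dart_mod.
case: k k6 kE => [|[|[|[|[|[|//]]]]]] _ kE.
- by left; apply: kE 0.
- by case: (hex_dart10_neq (esym (kE 0))).
- have := kE 4; rewrite (hex_dart_opp 1) [RHS]e6.
  by move/hex_dart10_neq.
- by right; rewrite (kE 0) (hex_dart_opp 0).
- by have := kE 0; rewrite (hex_dart_opp 1) => /esym/hex_dart10_neq.
- by have := kE 1; rewrite [RHS]e6 => /hex_dart10_neq.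
Qed.

Lemma hex_period_even i j : L i j -> exists a b, i = (2 * a)%Z /\ j = (2 * b)%Z.
Proof.
move=> Lij.
(* A half-integral half of a period would be the midpoint of an edge. *)
have aux k a b :
  k < 6 -> i = (2 * a + hex_dx k)%Z -> j = (2 * b + hex_dy k)%Z -> False.
  move=> k6 iE jE; have := rev_neq (e k a b).
  rewrite rev_hex_dart hex_dart_opp; case/eqP; apply/hex_dart_eq.
  have -> : (- (a + hex_dx k) - a = 0 - i)%Z by lia.
  have -> : (- (b + hex_dy k) - b = 0 - j)%Z by lia.
  exact: hex_periodB hex_period0 Lij.
exists (i / 2)%Z, (j / 2)%Z.
have iE := Z.div_mod i 2 ltac:(lia); have jE := Z.div_mod j 2 ltac:(lia).
have iB := Z.mod_pos_bound i 2 ltac:(lia).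
have jB := Z.mod_pos_bound j 2 ltac:(lia).
have [i2 | i2] : (i mod 2 = 0 \/ i mod 2 = 1)%Z by lia.
  have [j2 | j2] : (j mod 2 = 0 \/ j mod 2 = 1)%Z by lia.
    lia.
  by case: (aux 1 (i / 2)%Z (j / 2)%Z) => //; rewrite !hex_dE; lia.
have [j2 | j2] : (j mod 2 = 0 \/ j mod 2 = 1)%Z by lia.
  by case: (aux 0 (i / 2)%Z (j / 2)%Z) => //; rewrite !hex_dE; lia.
by case: (aux 2 (i / 2 + 1)%Z (j / 2)%Z) => //; rewrite !hex_dE; lia.
Qed.

(** Directions [k] and [k + 3] are exchanged by [hex_dart_opp]; restricting to [k < 3] selects one
    representative of each pair, as needed for counting darts. *)
Lemma hex_dart_inj_lt3 k i j k' i' j' : k < 3 -> k' < 3 ->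
  e k i j = e k' i' j' -> k = k' /\ L (i - i') (j - j').
Proof.
move=> k3 k'3.
wlog le_kk' : k k' i j i' j' k3 k'3 / k <= k' => [wlog_k|] ee.
  have [/wlog_k|/ltnW/wlog_k] := leqP k k'; first by apply.
  case/(_ _ _ _ _ k'3 k3 (esym ee)) => -> Lii; split=> //.
  have := hex_periodB hex_period0 Lii.
  by congr (L _ _); lia.
suff kk' : k = k' by split=> //; apply/(hex_dart_eq k); rewrite ee -kk'.
apply/eqP; rewrite eqn_leq le_kk' leqNgt; apply/negP => lt_kk'.
have ee' m : e (k + m) i j = e (k' + m) i' j'.
  by rewrite -!iter_rot_hex_dart ee.
have e6 a b : e 6 a b = e 0 a b by rewrite -hex_dart_mod.
case: k' k k'3 k3 {le_kk' ee} lt_kk' ee' => [|[|[|//]]] [|[|//]] //= _ _ _ ee.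
- by case: (hex_dart10_neq (esym (ee 0))).
- have := ee 4; rewrite (hex_dart_opp 1) [RHS]e6.
  by move/hex_dart10_neq.
- have := ee 5; rewrite [LHS]e6 -(hex_dart_mod (2 + 5)).
  by move/esym/hex_dart10_neq.
Qed.

(** Degree 3 means that three turns fix a dart, that is, that the half-turn about [(i, j)] belongs
    to the group of the covering. *)
Lemma degree_hex_vertex i j : degree (V i j) = 3 <-> L (2 * i) (2 * j).
Proof.
have LE : L (2 * i) (2 * j) <-> e 3 i j = e 0 i j.
  rewrite (hex_dart_opp 0); split=> [Lij|/esym/hex_dart_eq].
    by apply/esym/hex_dart_eq; move: Lij; congr (L _ _); lia.
  by congr (L _ _); lia.
have orderE : fingraph.order (@rot P) (e 0 i j) = degree (V i j).
  by rewrite order_rot.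
rewrite LE -(iter_rot_hex_dart 3 0); split=> [deg3|rot3].
  by rewrite -{1}deg3 -orderE iter_order //; apply: rot_inj.
have := orbit_uniq (@rot P) (e 0 i j); rewrite /fingraph.orbit orderE.
case: (deg36 (V i j)) => -> //=; move: rot3 => /= ->.
by rewrite !inE eqxx !orbT.
Qed.

(** The first [degree (V i j)] directions list every dart at the vertex exactly once. *)
Lemma edge_mult_hex_vertex i j y :
  edge_mult (V i j) y =
  \sum_(k < degree (V i j)) (V (i + hex_dx k) (j + hex_dy k) == y).
Proof.
have orderE : fingraph.order (@rot P) (e 0 i j) = degree (V i j).
  by rewrite order_rot.
rewrite -big_mkcond sum1dep_card /= /edge_mult.
pose f (k : 'I_(degree (V i j))) := e k i j.
have f_inj : injective f.
  move=> k k' ee; apply/val_inj/eqP.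
  rewrite -(nth_uniq (e 0 i j) _ _ (orbit_uniq (@rot P) (e 0 i j)));
    rewrite /fingraph.orbit ?size_traject orderE ?ltn_ord //.
  by rewrite !nth_traject ?ltn_ord // !iter_rot_hex_dart; apply/eqP.
rewrite -(card_imset _ f_inj); apply: eq_card => d; rewrite !inE.
apply/andP/imsetP=> [[/eqP dE dy]|[k + ->]]; last first.
  by rewrite inE /f src_hex_dart tgt_hex_dart eqxx.
have : fconnect (@rot P) (e 0 i j) d by rewrite rot_src dE.
move=> /[dup] /findex_max; rewrite orderE => lt_m /iter_findex mE.
exists (Ordinal lt_m); last by rewrite /f /= -(iter_rot_hex_dart _ 0) mE.
by rewrite inE -tgt_hex_dart /= -[_ _ i j](iter_rot_hex_dart _ 0) mE.
Qed.

End Triangulation.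

(** * The lattice of periods *)

Section Lattices.
Local Open Scope Z_scope.

Lemma Z_subgroup_mul (M : Z -> Z -> Prop) :
    (forall i j i' j', M i j -> M i' j' -> M (i - i') (j - j')) ->
  forall m i j, M i j -> M (m * i) (m * j).
Proof.
move=> MB m i j Mij; have M0 : M 0 0 by have := MB _ _ _ _ Mij Mij;
  rewrite !Z.sub_diag.
elim/Z.peano_ind: m => [|m IHm|m IHm]; first by rewrite !Z.mul_0_l.
  have MN : M (- i) (- j) by apply: (MB 0 0 i j M0 Mij).
  by have := MB _ _ _ _ IHm MN; congr (M _ _); lia.
by have := MB _ _ _ _ IHm Mij; congr (M _ _); lia.
Qed.

(** The generator is the least positive element; excluded middle replaces the decidability of [Q] in
    the descent. *)
Lemma Z_subgroup_generator (Q : Z -> Prop) (N : Z) :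
    (forall i j, Q i -> Q j -> Q (i - j)) -> 0 < N -> Q N ->
  exists2 g, 0 < g & forall i, Q i <-> exists m, i = g * m.
Proof.
move=> QB N0 QN.
have QM m i : Q i -> Q (m * i).
  by move=> Qi; apply: (@Z_subgroup_mul (fun i _ => Q i) _ m i 0) => // *;
    apply: QB.
have [g [g0 Qg gmin]] : exists g, [/\ 0 < g, Q g &
  forall i, 0 < i -> Q i -> g <= i].
  move: QN; have -> : N = Z.of_nat (Z.to_nat N) by lia.
  have : 0 < Z.of_nat (Z.to_nat N) by lia.
  move: {N N0} (Z.to_nat N) => n.
  elim/ltn_ind: n => n IHn n0 Qn.
  have [[i [i0 Qi lt_in]]|min] :=
    classic (exists i, [/\ 0 < i, Q i & i < Z.of_nat n]).
    apply: (IHn (Z.to_nat i)); [lia | lia |].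
    by have -> : Z.of_nat (Z.to_nat i) = i by lia.
  exists (Z.of_nat n); split=> // i i0 Qi; have [//|lt_in] :=
    Z.le_gt_cases (Z.of_nat n) i.
  by case: min; exists i.
exists g => // i; split=> [Qi|[m ->]]; last by rewrite Z.mul_comm; apply: QM.
exists (i / g).
have iE := Z.div_mod i g ltac:(lia); have iB := Z.mod_pos_bound i g g0.
suff : ~ 0 < i mod g by lia.
move=> i_gt0; have := gmin (i mod g) i_gt0.
have -> : i mod g = i - (i / g) * g by lia.
by move/(_ (QB _ _ Qi (QM _ _ Qg))); lia.
Qed.

(** A triangular basis: [(a, 0)] generates the intersection with the first axis, and [(b, c)] lies
    over the generator [c] of the projection to the second axis. *)
Lemma Z2_subgroup_basis (M : Z -> Z -> Prop) (N : Z) :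
    (forall i j i' j', M i j -> M i' j' -> M (i - i') (j - j')) ->
    0 < N -> M N 0 -> M 0 N ->
  exists a b c, [/\ 0 < a, 0 < c &
    forall i j, M i j <-> exists m n, i = a * m + b * n /\ j = c * n].
Proof.
move=> MB N0 MN0 M0N.
have MM := Z_subgroup_mul MB.
have [|//|//|a a0 aE] := @Z_subgroup_generator (fun i => M i 0) N.
  by move=> i j Mi Mj; have := MB _ _ _ _ Mi Mj; rewrite Z.sub_0_r.
have [|//||c c0 cE] := @Z_subgroup_generator (fun j => exists i, M i j) N.
- by move=> j j' [i Mi] [i' Mi']; exists (i - i'); apply: MB.
- by exists 0.
have [b Mbc] : exists b, M b c by apply/cE; exists 1; lia.
exists a, b, c; split=> // i j; split=> [Mij|[m [n [-> ->]]]].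
  have [n jE] : exists n, j = c * n by apply/cE; exists i.
  have := MB _ _ _ _ Mij (MM n _ _ Mbc).
  have -> : j - n * c = 0 by lia.
  by move/aE=> [m mE]; exists m, n; split=> //; lia.
have Ma : M (- (a * m)) 0 by apply/aE; exists (- m); lia.
have := MB _ _ _ _ (MM n _ _ Mbc) Ma.
by congr (M _ _); lia.
Qed.

End Lattices.

(** * Index and adapted basis of the lattice of periods *)

Section Periods.
Variable P : plane_graph.
Hypothesis tri : is_triangulation P.
Hypothesis deg36 : forall x : vertex P, degree x = 3 \/ degree x = 6.
Variable d0 : dart P.
Hypothesis cone0 : degree (src d0) = 3.

Local Notation e := (hex_dart d0).
Local Notation L := (hex_period d0).

(** The half-periods have index [a * c], hence the periods have index [4 * a * c]. Up to
    [hex_dart_opp], each class of points carries the three directions [k < 3]. *)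
Lemma card_dart_index a b c : (0 < a)%Z -> (0 < c)%Z ->
    (forall i j, L (2 * i) (2 * j) <->
       exists m n, i = (a * m + b * n)%Z /\ j = (c * n)%Z) ->
  #|dart P| = 12 * (Z.to_nat a * Z.to_nat c).
Proof.
move=> a0 c0 LE; set A := Z.to_nat a; set C := Z.to_nat c.
have LE' i j :
  L i j <-> exists m n, i = (2 * (a * m + b * n))%Z /\ j = (2 * (c * n))%Z.
  split=> [Lij|[m [n [-> ->]]]]; last by apply/LE; exists m, n.
  have [i' [j' [iE jE]]] := hex_period_even tri deg36 cone0 Lij.
  move: Lij; rewrite iE jE => /LE[m [n [mE nE]]].
  by exists m, n; rewrite mE nE.
pose f (p : 'I_3 * 'I_(2 * A) * 'I_(2 * C)) :=
  e p.1.1 (Z.of_nat p.1.2) (Z.of_nat p.2).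
have f_inj : injective f.
  move=> [[k i] j] [[k' i'] j'] /(hex_dart_inj_lt3 tri deg36 cone0) /=.
  case=> // kk' /LE'[m [n [iE jE]]].
  have := ltn_ord i; have := ltn_ord i'; have := ltn_ord j; have := ltn_ord j'.
  rewrite -!(rwP ltP) => jC j'C iA i'A.
  have n0 : n = 0%Z by nia.
  have m0 : m = 0%Z by nia.
  by congr (_, _, _); apply/val_inj => //=; lia.
suff f_surj d : d \in codom f.
  have -> : #|dart P| = #|codom f| by apply/esym/eq_card => d; rewrite f_surj.
  by rewrite (card_codom f_inj) !card_prod !card_ord; lia.
apply/codomP.
have [k [i [j [k3 ->]]]] : exists k i j, k < 3 /\ d = e k i j.
  have [k [i [j [k6 ->]]]] := hex_dart_surj tri deg36 d0 d.
  have [k3|k3] := ltnP k 3; first by exists k, i, j.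
  exists (k - 3), (- i)%Z, (- j)%Z; split; first lia.
  by rewrite -(hex_dart_opp tri deg36 cone0) subnK.
have jE := Z.div_mod j (2 * c) ltac:(lia).
have jB := Z.mod_pos_bound j (2 * c) ltac:(lia).
set n := (j / (2 * c))%Z in jE; set j0 := (j mod _)%Z in jE jB.
pose i1 := (i - 2 * b * n)%Z.
have iE := Z.div_mod i1 (2 * a) ltac:(lia).
have iB := Z.mod_pos_bound i1 (2 * a) ltac:(lia).
set m := (i1 / _)%Z in iE; set i0 := (i1 mod _)%Z in iE iB.
have i0A : Z.to_nat i0 < 2 * A by lia.
have j0C : Z.to_nat j0 < 2 * C by lia.
exists (Ordinal k3, Ordinal i0A, Ordinal j0C); rewrite /f /=.
apply/(hex_dart_eq tri deg36)/LE'; exists m, n.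
by rewrite /i1 in iE; lia.
Qed.

(* In the coordinates [2 * i + j] and [j], which are orthogonal up to scaling, a
   basis of the periods consists of a vertical vector and of a vector with the
   least positive first coordinate. *)
Lemma hex_period_basis :
    (forall i j, L i j -> exists j', j = (4 * j')%Z) ->
  exists u q h, [/\ (0 < u)%Z, (0 < q)%Z &
    forall i j, L i j <-> exists m n,
      (2 * i + j = 4 * q * m /\ j = 4 * h * m + 4 * u * n)%Z].
Proof.
move=> L4; have LB := @hex_periodB P tri deg36 d0.
have [N N0 [LN0 L0N]] := @hex_period_bound P d0.
have LM := Z_subgroup_mul LB.
(* Here [p] and [x] are the quarters of the coordinates [j] and [2 * i + j]. Taking [p] first makes
   the first basis vector vertical. *)
pose M p x := L (2 * x - 2 * p) (4 * p).
have [|||u [h [q [u0 q0 ME]]]] := @Z2_subgroup_basis M N _ N0.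
- move=> p x p' x' Mpx Mpx'; have := LB _ _ _ _ Mpx Mpx'.
  by rewrite /M; congr (L _ _); lia.
- by have := LB _ _ _ _ (LM 4 _ _ L0N)%Z (LM 2 _ _ LN0)%Z; congr (L _ _); lia.
- by have := LM 2%Z _ _ LN0; congr (L _ _); lia.
exists u, q, h; split=> // i j; split=> [Lij|[m [n [iE jE]]]].
  have [p pE] := L4 _ _ Lij.
  have [i' [_ [i'E _]]] := hex_period_even tri deg36 cone0 Lij.
  have /ME[n [m [mE nE]]] : M p (i' + p)%Z.
    by move: Lij; rewrite /M; congr (L _ _); lia.
  by exists m, n; lia.
have : M (u * n + h * m)%Z (q * m)%Z by apply/ME; exists n, m.
by rewrite /M; congr (L _ _); lia.
Qed.

End Periods.

(** * Choice of the direction of the rows *)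

Section EvenRows.
Variable P : plane_graph.
Hypothesis tri : is_triangulation P.
Hypothesis deg36 : forall x : vertex P, degree x = 3 \/ degree x = 6.

(** Turning the base dart about its source turns the lattice of periods, by the conjugation formula
    [hexTTS]. *)
Lemma hex_period_rot (d : dart P) i j :
  hex_period (rot d) i j <-> hex_period d (- j) (i + j).
Proof.
have -> : rot d = rot_perm P d by rewrite permE.
rewrite /hex_period /hex_dart !mulg1 -permM.
rewrite -[(_ * _)%g](mulgKV (rot_perm P)).
rewrite (hexTTS (rot_perm6 deg36) (rev_perm2 P) (face_perm3 tri)) permM.
by split=> [/perm_inj|->].
Qed.

(* The index [a * c] of the lattice of half-periods is [n - 1], which is even; so
   the half-periods miss a class modulo 2, and they all lie in every other row of
   one of the three directions. *)
Lemma even_rows n : #|vertex P| = 2 * n -> odd n ->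
  exists2 d0 : dart P, degree (src d0) = 3 &
    forall i j, hex_period d0 i j -> exists j', j = (4 * j')%Z.
Proof.
move=> cardV n_odd; have [d d3] := degree3_exists tri deg36.
have LB := @hex_periodB P tri deg36 d.
have [N N0 [LN0 L0N]] := @hex_period_bound P d.
have LM := Z_subgroup_mul LB.
pose M i j := hex_period d (2 * i) (2 * j).
have [|||a [b [c [a0 c0 ME]]]] := @Z2_subgroup_basis M N _ N0.
- move=> i j i' j' Mij Mij'; have := LB _ _ _ _ Mij Mij'.
  by rewrite /M; congr (hex_period _ _ _); lia.
- exact: (LM 2%Z _ _ LN0).
- exact: (LM 2%Z _ _ L0N).
have LE i j : hex_period d i j -> exists m n',
    (i = 2 * (a * m + b * n') /\ j = 2 * (c * n'))%Z.
  move=> Lij; have [i' [j' [iE jE]]] := hex_period_even tri deg36 d3 Lij.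
  move: Lij; rewrite iE jE => /ME[m [n' [mE nE]]].
  by exists m, n'; rewrite mE nE.
have := card_dart_index tri deg36 d3 a0 c0 ME.
have := euler_count tri; rewrite cardV => cardD cardD'.
have acE : Z.to_nat a * Z.to_nat c = n.-1 by lia.
have : ~~ odd (Z.to_nat a * Z.to_nat c) by rewrite acE; lia.
rewrite oddM negb_and => ac_even.
have degr d' : degree (src (rot d')) = degree (src d').
  by congr degree; apply/eqP; rewrite eq_sym -rot_src fconnect1.
(* According to the parities of [c], [a] and [b], all periods have [j], [i] or [i + j] divisible by
   4; zero, one or two turns of the base dart make this form, up to sign, the second coordinate. *)
have [[c' cE]|[c' cE]] := Z.Even_or_Odd c.
  by exists d => // i j /LE[m [n' [_ ->]]]; exists (c' * n')%Z; lia.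
have [[a' aE]|[a' aE]] := Z.Even_or_Odd a; last by exfalso; move: ac_even; lia.
have [[b' bE]|[b' bE]] := Z.Even_or_Odd b.
  exists (rot d); first by rewrite degr.
  move=> i j /hex_period_rot/LE[m [n' [jE _]]].
  by exists (- (a' * m + b' * n'))%Z; lia.
exists (rot (rot d)); first by rewrite !degr.
move=> i j /hex_period_rot/hex_period_rot/LE[m [n' [iE jE]]].
by exists (- (a' * m + b' * n' + c' * n' + n'))%Z; lia.
Qed.

End EvenRows.

(** * The path and its complement *)

Section Neighbours.
Variable P : plane_graph.
Hypothesis tri : is_triangulation P.
Hypothesis deg36 : forall x : vertex P, degree x = 3 \/ degree x = 6.
Variable d0 : dart P.
Hypothesis cone0 : degree (src d0) = 3.

Local Notation V := (hex_vertex d0).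

Definition hex_nbr k i j : vertex P := V (i + hex_dx k) (j + hex_dy k).

(** At a vertex of degree 3 opposite directions lead to the same neighbour, so that a sum over the
    six directions counts every edge twice; the factor [6 %/ degree] corrects this. The list [ks]
    contains all directions that may lead to [y]. *)
Lemma hex_nbr_mult i j y (ks : seq nat) :
    uniq ks -> all (gtn 6) ks ->
    (forall k, k < 6 -> k \notin ks -> hex_nbr k i j <> y) ->
  (6 %/ degree (V i j)) * edge_mult (V i j) y =
  \sum_(k <- ks) (hex_nbr k i j == y).
Proof.
move=> ks_uniq /allP ks6 ksP; rewrite (edge_mult_hex_vertex tri deg36).
transitivity (\sum_(k < 6) (hex_nbr k i j == y)); last first.
  have ks_perm : perm_eq ks [seq k <- iota 0 6 | k \in ks].
    apply: uniq_perm => //; first by rewrite filter_uniq ?iota_uniq.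
    move=> k; rewrite mem_filter mem_iota /=.
    by case: (boolP (k \in ks)) => // /ks6 /= ->.
  rewrite (perm_big _ ks_perm) big_filter [RHS]big_mkcond.
  rewrite -(big_mkord xpredT (fun k => (hex_nbr k i j == y) :
    nat)) /index_iota subn0.
  apply: eq_big_seq => k; rewrite mem_iota => k6.
  by case: ifPn => // /(ksP k k6)/eqP/negbTE ->.
case: (deg36 (V i j)) => [cone|deg6]; last by rewrite deg6 mul1n.
rewrite cone mul2n -addnn -[6]/(3 + 3) big_split_ord /=; congr (_ + _).
apply: eq_bigr => k _; congr (nat_of_bool (_ == _)).
have /(degree_hex_vertex tri deg36 cone0) Lij := cone.
apply/(hex_vertex_eq tri deg36 cone0); right.
move: Lij; move: (nat_of_ord k) (ltn_ord k) => {}k.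
by case: k => [|[|[|//]]] _; congr (hex_period _ _ _); rewrite !hex_dE; lia.
Qed.

End Neighbours.

Section Partition.
Variable P : plane_graph.
Hypothesis tri : is_triangulation P.
Hypothesis deg36 : forall x : vertex P, degree x = 3 \/ degree x = 6.
Variable d0 : dart P.
Hypothesis cone0 : degree (src d0) = 3.
Variables u q h : Z.
Hypotheses (u0 : (0 < u)%Z) (q0 : (0 < q)%Z).
Hypothesis periodE : forall i j, hex_period d0 i j <-> exists m n,
  (2 * i + j = 4 * q * m /\ j = 4 * h * m + 4 * u * n)%Z.

Local Notation V := (hex_vertex d0).
Local Notation nbr := (hex_nbr d0).
Local Open Scope Z_scope.

Lemma lattice_vertex_opp i j : V (- i) (- j) = V i j.
Proof.
apply/(hex_vertex_eq tri deg36 cone0); right; apply/periodE; exists 0, 0; lia.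
Qed.

Lemma lattice_vertex_period m n i j i' j' :
  2 * (i - i') + (j - j') = 4 * q * m -> j - j' = 4 * h * m + 4 * u * n ->
  V i j = V i' j'.
Proof.
by move=> iE jE; apply/(hex_vertex_eq tri deg36 cone0); left; apply/periodE;
  exists m, n.
Qed.

Lemma lattice_vertex_inv i j i' j' : V i j = V i' j' -> exists m n,
  (2 * (i - i') + (j - j') = 4 * q * m /\ j - j' = 4 * h * m + 4 * u * n) \/
  (2 * (i + i') + (j + j') = 4 * q * m /\ j + j' = 4 * h * m + 4 * u * n).
Proof.
case/(hex_vertex_eq tri deg36 cone0)=> /periodE[m [n mn]]; exists m, n.
  by left.
by right.
Qed.

(* In the coordinates [X = 2 * i + j] and [Y = j], the first part consists of the
   even rows without the columns [X = 0 mod 4q], and of the points of the odd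
   rows next to these columns with [(X, Y) = (1, 1)] or [(-1, -1) mod (4q, 4)]. *)
Definition part i j :=
  [\/ exists2 w, j = 2 * w & forall m, 2 * i + j <> 4 * q * m,
       exists m w, 2 * i + j = 4 * q * m + 1 /\ j = 4 * w + 1 |
       exists m w, 2 * i + j = 4 * q * m - 1 /\ j = 4 * w - 1].

(** Periods change [X] by multiples of [4 * q] and [Y] by multiples of 4, and negation exchanges the
    last two clauses of [part]; so [part] is a property of vertices of [P]. *)
Lemma part_vertex i j i' j' : V i j = V i' j' -> part i j -> part i' j'.
Proof.
have part_opp a b : part a b -> part (- a) (- b).
  case=> [[w bE ab]|[m [w [aE bE]]]|[m [w [aE bE]]]].
  - by constructor 1; exists (- w) => [|m]; [lia | have := ab (- m); lia].
  - by constructor 3; exists (- m), (- w); lia.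
  - by constructor 2; exists (- m), (- w); lia.
have part_period m n a b a' b' : 2 * (a - a') + (b - b') = 4 * q * m ->
    b - b' = 4 * h * m + 4 * u * n -> part a b -> part a' b'.
  move=> aE bE [[w bE' ab]|[m' [w [aE' bE']]]|[m' [w [aE' bE']]]].
  - constructor 1; exists (w - 2 * h * m - 2 * u * n) => [|m']; first lia.
    by have := ab (m + m'); lia.
  - by constructor 2; exists (m' - m), (w - h * m - u * n); lia.
  - by constructor 3; exists (m' - m), (w - h * m - u * n); lia.
case/lattice_vertex_inv=> m [n [[mE nE]|[mE nE]]] pij.
  exact: part_period mE nE pij.
rewrite -(Z.opp_involutive i') -(Z.opp_involutive j'); apply: part_opp.
by apply: (part_period m n) pij; lia.
Qed.

(** Only the columns [X = - 4 * q], [0] and [4 * q] are close to this strip, so the quantifiers over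
    [m] reduce to linear conditions that [lia] can handle. *)
Lemma part_range i j : - 4 * q - 1 <= 2 * i + j <= 4 * q + 1 -> part i j <->
  [\/ exists2 w, j = 2 * w & [/\ 2 * i + j <> 0, 2 * i + j <> 4 * q &
    2 * i + j <> - 4 * q],
       exists2 w, j = 4 * w + 1 &
         [\/ 2 * i + j = 1, 2 * i + j = 4 * q + 1 | 2 * i + j = 1 - 4 * q] |
       exists2 w, j = 4 * w - 1 &
         [\/ 2 * i + j = -1, 2 * i + j = 4 * q - 1 | 2 * i + j = - 4 * q - 1]].
Proof.
have small m : - 4 * q - 2 <= 4 * q * m <= 4 * q + 2 -> [\/ m = 0, m = 1 |
  m = -1].
  move=> mB; have mB' : -1 <= m <= 1 by nia.
  have [->|[->|->]] : m = 0 \/ m = 1 \/ m = -1 by lia.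
  - by constructor 1.
  - by constructor 2.
  - by constructor 3.
move=> ij; split=> [[[w jE iE]|[m [w [iE jE]]]|[m [w [iE jE]]]]|].
- constructor 1; exists w => //; split; first by have := iE 0; lia.
    by have := iE 1; lia.
  by have := iE (-1); lia.
- constructor 2; exists w => //.
  have [mE|mE|mE] := small m ltac:(lia);
    [constructor 1|constructor 2|constructor 3]; lia.
- constructor 3; exists w => //.
  have [mE|mE|mE] := small m ltac:(lia);
    [constructor 1|constructor 2|constructor 3]; lia.
case=> [[w jE [n0 n1 n2]]|[w jE [iE|iE|iE]]|[w jE [iE|iE|iE]]].
- constructor 1; exists w => // m mE.
  have [m1|m1|m1] := small m ltac:(lia); lia.
- by constructor 2; exists 0, w; lia.
- by constructor 2; exists 1, w; lia.
- by constructor 2; exists (-1), w; lia.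
- by constructor 3; exists 0, w; lia.
- by constructor 3; exists 1, w; lia.
- by constructor 3; exists (-1), w; lia.
Qed.

Let mul_lt a m k : 0 < a -> a * m < a * k -> m < k.
Proof. by move=> a0; apply: (proj2 (Z.mul_lt_mono_pos_l a m k a0)). Qed.

Let mul_between a m k : 0 < a -> a * (k - 1) < a * m < a * (k + 1) -> m = k.
Proof. by move=> a0 [/(mul_lt a0) mk /(mul_lt a0)]; lia. Qed.

(** * The snake through the even rows *)

Definition snake_sign t := if Z.even (t + h) then -1 else 1.

(* The position on the snake is [2 * q * t + i] with [- q < i <= q]: the
   positions with [i < q] run through the row [Y = 2 * h + 2 * t], in the
   direction [snake_sign t], and [i = q] is the step to the next row. *)
Definition snake (z : Z) : vertex P :=
  let t := (z + q - 1) / (2 * q) in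
  let i := z - 2 * q * t in
  if i <? q then V (q + snake_sign t * i - h - t) (2 * h + 2 * t)
  else V (if Z.even (t + h) then - h - t else 2 * q - 1 - h - t) (2 * h + 2 * t + 1).

Lemma snake_signP t :
  (exists2 p, t + h = 2 * p & snake_sign t = -1 /\ Z.even (t + h) = true) \/
  (exists2 p, t + h = 2 * p + 1 & snake_sign t = 1 /\ Z.even (t + h) = false).
Proof.
rewrite /snake_sign; have [[p pE]|[p pE]] := Z.Even_or_Odd (t + h).
  by left; exists p; rewrite // (_ : Z.even _ = true) //; apply/Z.even_spec;
    exists p.
right; exists p; rewrite // (_ : Z.even _ = false) // -Z.negb_odd.
by rewrite (_ : Z.odd _ = true) //; apply/Z.odd_spec; exists p.
Qed.

Let quotE t i : - q < i <= q -> (2 * q * t + i + q - 1) / (2 * q) = t.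
Proof. by move=> iq; symmetry; apply: (Z.div_unique_pos _ _ _ (i + q - 1));
  lia. Qed.

Lemma snake_row t i : - q < i < q ->
  snake (2 * q * t + i) = V (q + snake_sign t * i - h - t) (2 * h + 2 * t).
Proof.
move=> iq; rewrite /snake quotE; last by lia.
have -> : 2 * q * t + i - 2 * q * t = i by lia.
by case: Z.ltb_spec => //; lia.
Qed.

Lemma snake_step t : snake (2 * q * t + q) =
  V (if Z.even (t + h) then - h - t else 2 * q - 1 - h - t) (2 * h + 2 * t + 1).
Proof.
rewrite /snake quotE; last by lia.
have -> : 2 * q * t + q - 2 * q * t = q by lia.
by case: Z.ltb_spec => //; lia.
Qed.

Lemma snakeP z :
  (exists t i, z = 2 * q * t + i /\ - q < i < q) \/ (exists t, z = 2 * q * t + q).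
Proof.
pose t := (z + q - 1) / (2 * q).
have tE := Z.div_mod (z + q - 1) (2 * q) ltac:(lia).
have tB := Z.mod_pos_bound (z + q - 1) (2 * q) ltac:(lia).
have [iq|iq] := Z.lt_ge_cases (z - 2 * q * t) q.
  by left; exists t, (z - 2 * q * t); rewrite /t in iq *; lia.
by right; exists t; rewrite /t in iq *; lia.
Qed.

Lemma snake_part z i j : snake z = V i j -> part i j.
Proof.
case: (snakeP z) => [[t [l [-> lq]]]|[t ->]].
  rewrite snake_row // => /part_vertex; apply; apply/part_range.
    by case: (snake_signP t) => [[p _ [-> _]]|[p _ [-> _]]]; lia.
  constructor 1; exists (h + t); first lia.
  by case: (snake_signP t) => [[p _ [-> _]]|[p _ [-> _]]]; split; lia.
rewrite snake_step => /part_vertex; apply; case: (snake_signP t) =>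
  [[p pE [_ ->]]|[p pE [_ ->]]].
  by constructor 2; exists 0, p; lia.
by constructor 3; exists 1, (p + 1); lia.
Qed.

(** The half-turn about the degree 3 vertex [(X, Y) = (2 * q, 2 * h)], at position 0, reverses the
    snake. *)
Lemma snake_opp z : snake (- z) = snake z.
Proof.
have signN t : snake_sign (- t) = snake_sign t.
  by case: (snake_signP t) => [[p pE [-> _]]|[p pE [-> _]]];
     case: (snake_signP (- t)) => [[p' pE' [-> _]]|[p' pE' [-> _]]]; lia.
case: (snakeP z) => [[t [l [-> lq]]]|[t ->]].
  have -> : - (2 * q * t + l) = 2 * q * (- t) + (- l) by lia.
  rewrite !snake_row ?signN; try lia; rewrite -lattice_vertex_opp.
  by apply: (@lattice_vertex_period (-1) 0); lia.
have -> : - (2 * q * t + q) = 2 * q * (- t - 1) + q by lia.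
rewrite !snake_step -lattice_vertex_opp.
by case: (snake_signP t) => [[p pE [_ ->]]|[p pE [_ ->]]];
   case: (snake_signP (- t - 1)) => [[p' pE' [_ ->]]|[p' pE' [_ ->]]];
   apply: (@lattice_vertex_period (-1) 0); lia.
Qed.

Lemma snake_period z : snake (z + 4 * q * u) = snake z.
Proof.
have signD t : snake_sign (t + 2 * u) = snake_sign t.
  by case: (snake_signP t) => [[p pE [-> _]]|[p pE [-> _]]];
     case: (snake_signP (t + 2 * u)) => [[p' pE' [-> _]]|[p' pE' [-> _]]]; lia.
case: (snakeP z) => [[t [l [-> lq]]]|[t ->]].
  have -> : 2 * q * t + l + 4 * q * u = 2 * q * (t + 2 * u) + l by lia.
  by rewrite !snake_row ?signD //; apply: (@lattice_vertex_period 0 1); lia.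
have -> : 2 * q * t + q + 4 * q * u = 2 * q * (t + 2 * u) + q by lia.
rewrite !snake_step.
by case: (snake_signP t) => [[p pE [_ ->]]|[p pE [_ ->]]];
   case: (snake_signP (t + 2 * u)) => [[p' pE' [_ ->]]|[p' pE' [_ ->]]];
   apply: (@lattice_vertex_period 0 1); lia.
Qed.

(** Half of the period [4 * q * u]: the reversal at 0 and the period fold the infinite snake onto
    this segment, whose two ends have degree 3. *)
Let range z := 0 <= z <= 2 * q * u.

Lemma snake_inj z z' : range z -> range z' -> snake z = snake z' -> z = z'.
Proof.
case: (snakeP z) => [[t [l [-> lq]]]|[t ->]] zB;
  case: (snakeP z') => [[t' [l' [-> lq']]]|[t' ->]] zB'.
- have [tB tB'] : 0 <= t <= u /\ 0 <= t' <= u.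
    have aux a b : - q < b < q -> range (2 * q * a + b) -> 0 <= a <= u.
      rewrite /range => bq ab; suff : -1 < a /\ a < u + 1 by lia.
      by split; apply: (@mul_lt (2 * q)); lia.
    by split; [apply: (aux t l) | apply: (aux t' l')].
  rewrite !snake_row // => /lattice_vertex_inv[m [n [[mE nE]|[mE nE]]]].
    have m0 : m = 0.
      case: (snake_signP t) mE => [[p pE [-> _]]|[p pE [-> _]]];
      case: (snake_signP t') => [[p' pE' [-> _]]|[p' pE' [-> _]]] mE; apply:
        (@mul_between (4 * q)); lia.
    rewrite m0 in mE nE; have n0 : n = 0 by apply: (@mul_between (4 * u)); lia.
    have tt' : t = t' by lia.
    rewrite tt' in mE *; congr (_ + _).
    by case: (snake_signP t') mE => [[p pE [-> _]]|[p pE [-> _]]]; lia.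
  (* Both first coordinates lie strictly between [0] and [4 * q], so their sum [4 * q * m] forces
     [m = 1]. The half-turn is then about one end of the segment, which is its only fixed position
     there. *)
  have m1 : m = 1.
    case: (snake_signP t) mE => [[p pE [-> _]]|[p pE [-> _]]];
    case: (snake_signP t') => [[p' pE' [-> _]]|[p' pE' [-> _]]] mE; apply:
      (@mul_between (4 * q)); lia.
  rewrite m1 in mE nE.
  have ttn : t + t' = 2 * u * n by lia.
  have n01 : n = 0 \/ n = 1.
    suff : -1 < n /\ n < 2 by lia.
    by split; apply: (@mul_lt (2 * u)); lia.
  have tt' : t = t' /\ (t = 0 \/ t = u) by case: n01 ttn => -> ; lia.
  case: tt' => tt' t0u; rewrite -tt' in mE zB' *.
  have ll' : l = - l'.
    by case: (snake_signP t) mE => [[p pE [-> _]]|[p pE [-> _]]]; lia.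
  by case: t0u zB zB' => ->; rewrite /range; lia.
- rewrite snake_row // snake_step =>
  /lattice_vertex_inv[m [n [[mE nE]|[mE nE]]]]; lia.
- rewrite snake_step snake_row // =>
  /lattice_vertex_inv[m [n [[mE nE]|[mE nE]]]]; lia.
have [tB tB'] : 0 <= t < u /\ 0 <= t' < u.
  have aux a : range (2 * q * a + q) -> 0 <= a < u.
    rewrite /range => ab; suff : -1 < a /\ a < u by lia.
    by split; apply: (@mul_lt (2 * q)); lia.
  by split; apply: aux.
rewrite !snake_step => /lattice_vertex_inv[m [n [[mE nE]|[mE nE]]]].
  have m0 : m = 0.
    case: (snake_signP t) mE => [[p pE [_ ->]]|[p pE [_ ->]]];
    case: (snake_signP t') => [[p' pE' [_ ->]]|[p' pE' [_ ->]]] mE; apply: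
      (@mul_between (4 * q)); lia.
  rewrite m0 in nE; have n0 : n = 0 by apply: (@mul_between (4 * u)); lia.
  by congr (2 * q * _ + q); lia.
have m1 : m = 1.
  case: (snake_signP t) mE => [[p pE [_ ->]]|[p pE [_ ->]]];
  case: (snake_signP t') => [[p' pE' [_ ->]]|[p' pE' [_ ->]]] mE; apply:
    (@mul_between (4 * q)); lia.
rewrite m1 in nE; suff : 0 < n /\ n < 1 by lia.
by split; apply: (@mul_lt (4 * u)); lia.
Qed.

Lemma lattice_degree3 i j : degree (V i j) = 3%N <->
  exists m n, 2 * i + j = 2 * q * m /\ j = 2 * h * m + 2 * u * n.
Proof.
rewrite (degree_hex_vertex tri deg36 cone0) periodE.
by split=> -[m [n mn]]; exists m, n; lia.
Qed.

Lemma snake_degree3 z :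
  range z -> degree (snake z) = 3%N <-> z = 0 \/ z = 2 * q * u.
Proof.
case: (snakeP z) => [[t [l [-> lq]]]|[t ->]].
  rewrite /range snake_row // => zB; split=> [/lattice_degree3[m [n [mE nE]]]|z0].
    have [m1 l0] : m = 1 /\ l = 0.
      suff m1 : m = 1.
        by rewrite m1 in mE; split=> //; case: (snake_signP t) mE =>
          [[p pE [-> _]]|[p pE [-> _]]]; lia.
      case: (snake_signP t) mE => [[p pE [-> _]]|[p pE [-> _]]] mE;
      apply: (@mul_between (2 * q)); lia.
    rewrite m1 l0 in mE nE zB *.
    have tE : t = u * n by lia.
    have tB : -1 < t /\ t < u + 1 by split; apply: (@mul_lt (2 * q)); lia.
    have nB : -1 < n /\ n < 2 by split; apply: (@mul_lt u); lia.
    have [n0|n0] : n = 0 \/ n = 1 by lia.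
      by left; rewrite tE n0; lia.
    by right; rewrite tE n0; lia.
  have [n tE] : exists n, t = u * n.
    case: z0 => z0; [exists 0; rewrite Z.mul_0_r | exists 1; rewrite Z.mul_1_r];
    apply: (@mul_between (2 * q)); lia.
  have l0 : l = 0.
    have [t0|t0] : t = 0 \/ t = u.
    - case: z0 => z0; [left | right]; apply: (@mul_between (2 * q)); lia.
    - by rewrite t0 in z0 zB; case: z0 => z0; nia.
    - by rewrite t0 in z0 zB; case: z0 => z0; nia.
  by apply/lattice_degree3; exists 1, n; rewrite l0; lia.
rewrite /range snake_step => zB; split=> [/lattice_degree3[m [n [mE nE]]]|[]];
  try lia.
  by move=> tE; exfalso; have : t < 0 /\ -1 < t; [split; apply:
    (@mul_lt (2 * q)); lia | lia].
by move=> tE; exfalso; have : t < u /\ u - 1 < t; [split; apply: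
  (@mul_lt (2 * q)); lia | lia].
Qed.

Lemma not_part_range i j : - 4 * q - 1 <= 2 * i + j <= 4 * q + 1 ->
  ~ [\/ exists2 w, j = 2 * w & [/\ 2 * i + j <> 0, 2 * i + j <> 4 * q &
    2 * i + j <> - 4 * q],
       exists2 w, j = 4 * w + 1 &
         [\/ 2 * i + j = 1, 2 * i + j = 4 * q + 1 | 2 * i + j = 1 - 4 * q] |
       exists2 w, j = 4 * w - 1 &
         [\/ 2 * i + j = -1, 2 * i + j = 4 * q - 1 | 2 * i + j = - 4 * q - 1]] ->
  ~ part i j.
Proof. by move=> ij nP pij; apply: nP; apply/part_range. Qed.

Local Ltac not_part_lia :=
  apply: not_part_range;
  [lia | case=> [[? ? [? ? ?]]|[? ? [?|?|?]]|[? ? [?|?|?]]]; lia].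

Lemma not_part_nbrs (ks : seq nat) i j :
    - 4 * q + 1 <= 2 * i + j <= 4 * q - 1 ->
    (forall l, (l < 6)%N -> l \notin ks ->
      let b := j + hex_dy l in let a := 2 * (i + hex_dx l) + b in
      ~ [\/ exists2 w, b = 2 * w & [/\ a <> 0, a <> 4 * q & a <> - 4 * q],
            exists2 w, b = 4 * w + 1 & [\/ a = 1, a = 4 * q + 1 | a = 1 - 4 * q] |
            exists2 w, b = 4 * w - 1 &
              [\/ a = -1, a = 4 * q - 1 | a = - 4 * q - 1]]) ->
  forall l, (l < 6)%N -> l \notin ks -> ~ part (i + hex_dx l) (j + hex_dy l).
Proof.
move=> ij nP l l6 lk; move/part_range=> pl; apply: (nP l l6 lk); apply: pl.
by case: l l6 {nP lk} => [|[|[|[|[|[|//]]]]]] _; rewrite !hex_dE; lia.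
Qed.

Local Ltac nbrs_lia :=
  split=> //;
  [ by rewrite /hex_nbr !hex_dE; congr (V _ _); lia
  | by rewrite /hex_nbr !hex_dE; congr (V _ _); lia
  | apply: not_part_nbrs; [lia|];
    case=> [|[|[|[|[|[|//]]]]]] _;
    first [by case/negP | move=> _; rewrite !hex_dE; cbv zeta];
    case=> [[? ? [? ? ?]]|[? ? [?|?|?]]|[? ? [?|?|?]]]; lia ].

Lemma snake_nbrs z : exists i j k k',
  [/\ snake z = V i j, nbr k i j = snake (z + 1), nbr k' i j = snake (z - 1),
      uniq [:: k; k'] && all (gtn 6%N) [:: k; k'] &
      forall l, (l < 6)%N -> l \notin [:: k; k'] ->
        ~ part (i + hex_dx l) (j + hex_dy l)].
Proof.
case: (snakeP z) => [[t [l [-> lq]]]|[t ->]]; last first.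
  exists (if Z.even (t + h) then - h - t else 2 * q - 1 - h - t), (2 * h + 2 * t + 1).
  rewrite snake_step.
  have -> : 2 * q * t + q + 1 = 2 * q * (t + 1) + (1 - q) by lia.
  have -> : 2 * q * t + q - 1 = 2 * q * t + (q - 1) by lia.
  rewrite !snake_row; try lia.
  case: (snake_signP t) => [[p pE [-> ->]]|[p pE [-> ->]]];
  case: (snake_signP (t + 1)) => [[p' pE' [-> _]]|[p' pE' [-> _]]]; try lia.
    by exists 1%N, 5%N; nbrs_lia.
  by exists 2%N, 4%N; nbrs_lia.
exists (q + snake_sign t * l - h - t), (2 * h + 2 * t).
rewrite snake_row //.
have [up|up] := Z.lt_ge_cases (l + 1) q.
  have -> : 2 * q * t + l + 1 = 2 * q * t + (l + 1) by lia.
  rewrite (@snake_row t (l + 1)); last by lia.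
  have [dn|dn] := Z.lt_ge_cases (- q) (l - 1).
    have -> : 2 * q * t + l - 1 = 2 * q * t + (l - 1) by lia.
    rewrite snake_row; last by lia.
    case: (snake_signP t) => [[p pE [-> _]]|[p pE [-> _]]].
      by exists 3%N, 0%N; nbrs_lia.
    by exists 0%N, 3%N; nbrs_lia.
  have -> : 2 * q * t + l - 1 = 2 * q * (t - 1) + q by lia.
  rewrite snake_step; case: (snake_signP t) => [[p pE [-> _]]|[p pE [-> _]]];
  case: (snake_signP (t - 1)) => [[p' pE' [_ ->]]|[p' pE' [_ ->]]]; try lia.
    by exists 3%N, 5%N; nbrs_lia.
  by exists 0%N, 4%N; nbrs_lia.
have -> : 2 * q * t + l + 1 = 2 * q * t + q by lia.
rewrite snake_step.
have [dn|dn] := Z.lt_ge_cases (- q) (l - 1).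
  have -> : 2 * q * t + l - 1 = 2 * q * t + (l - 1) by lia.
  rewrite snake_row; last by lia.
  case: (snake_signP t) => [[p pE [-> ->]]|[p pE [-> ->]]].
    by exists 2%N, 0%N; nbrs_lia.
  by exists 1%N, 3%N; nbrs_lia.
(* Here [q = 1]: the row is reduced to the position [l = 0], between two steps. *)
have -> : 2 * q * t + l - 1 = 2 * q * (t - 1) + q by lia.
rewrite snake_step; case: (snake_signP t) => [[p pE [-> ->]]|[p pE [-> ->]]];
case: (snake_signP (t - 1)) => [[p' pE' [_ ->]]|[p' pE' [_ ->]]]; try lia.
  by exists 2%N, 5%N; nbrs_lia.
by exists 1%N, 4%N; nbrs_lia.
Qed.

(** A period first moves the point into the strip between [X = 0] and [X = 4 * q], which the
    infinite snake exhausts; [snake_period] and [snake_opp] then bring the position into the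
    range. *)
Lemma snake_surj i j : part i j -> exists2 z, range z & V i j = snake z.
Proof.
move=> pij; have [z ->] : exists z, V i j = snake z.
  case: pij => [[w jE iE]|[m [w [iE jE]]]|[m [w [iE jE]]]].
  - pose m := (i + w) / (2 * q); pose t := w - 2 * h * m - h.
    have mE := Z.div_mod (i + w) (2 * q) ltac:(lia).
    have mB := Z.mod_pos_bound (i + w) (2 * q) ltac:(lia).
    pose l := (i + w - 2 * q * m) - q.
    have l_neq : l <> - q by have := iE m; rewrite /l; lia.
    have lq : - q < l < q by move: l_neq; rewrite /l /m; lia.
    exists (2 * q * t + snake_sign t * l).
    rewrite snake_row; last by case: (snake_signP t) =>
      [[_ _ [-> _]]|[_ _ [-> _]]]; lia.
    have -> : q + snake_sign t * (snake_sign t * l) - h - t = q + l - h - t.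
      by case: (snake_signP t) => [[_ _ [-> _]]|[_ _ [-> _]]]; lia.
    by apply: (@lattice_vertex_period m 0); rewrite /l /t; lia.
  - pose t := 2 * w - 2 * h * m - h; exists (2 * q * t + q).
    rewrite snake_step; case: (snake_signP t) => [[p pE [_ ->]]|[p pE _]];
      rewrite /t in pE *; last by lia.
    by apply: (@lattice_vertex_period m 0); lia.
  pose t := 2 * w - 1 - 2 * h * (m - 1) - h; exists (2 * q * t + q).
  rewrite snake_step; case: (snake_signP t) => [[p pE _]|[p pE [_ ->]]];
    rewrite /t in pE *; first by lia.
  by apply: (@lattice_vertex_period (m - 1) 0); lia.
have snakeM m a : snake (a + 4 * q * u * m) = snake a.
  elim/Z.peano_ind: m => [|m IHm|m IHm]; first by congr snake; lia.
    by rewrite -IHm -[RHS]snake_period; congr snake; lia.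
  by rewrite -IHm -[LHS]snake_period; congr snake; lia.
have zE := Z.div_mod z (4 * q * u) ltac:(lia).
have zB := Z.mod_pos_bound z (4 * q * u) ltac:(lia).
set m := z / _ in zE; set a := z mod _ in zE zB.
have -> : snake z = snake a by rewrite zE Z.add_comm snakeM.
have [le_a|lt_a] := Z.le_gt_cases a (2 * q * u); first by exists a => //;
  rewrite /range; lia.
exists (4 * q * u - a); first by rewrite /range; lia.
by rewrite -snake_opp -snake_period; congr snake; lia.
Qed.

(** At the two ends the positions [z - 1] and [z + 1] give the same vertex; this double count
    cancels the factor 2 of [hex_nbr_mult], leaving a simple edge. *)
Lemma snake_edge z z' : range z -> range z' ->
  edge_mult (snake z) (snake z') = ((z' =? z + 1) || (z =? z' + 1)) :> nat.
Proof.
move=> zB z'B; have [i [j [k [k' [zE kE k'E /andP[ks_uniq ks6] nP]]]]] :=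
  snake_nbrs z.
have := hex_nbr_mult tri deg36 cone0 ks_uniq ks6 (i := i) (j := j) (y :=
  snake z').
rewrite -zE !big_cons big_nil kE k'E addn0 => /(_ _)/wrap[].
  move=> l l6 lk lE; apply: (nP l l6 lk); exact: snake_part (esym lE).
have nbrE a : range a -> (snake a == snake z') = (a =? z').
  move=> aB; case: Z.eqb_spec => [-> |neq]; first exact: eqxx.
  by apply/eqP => /(snake_inj aB z'B).
have [/(snake_degree3 zB) z0|deg6] := deg36 (snake z).
  rewrite (proj2 (snake_degree3 zB) z0).
  case: z0 => z0.
    rewrite (_ : snake (z - 1) = snake (z + 1)); last first.
      by rewrite -[LHS]snake_opp; congr snake; lia.
    rewrite nbrE; last by rewrite /range; nia.
    by case: Z.eqb_spec; case: Z.eqb_spec; case: Z.eqb_spec;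
      rewrite /range in zB z'B; lia.
  rewrite (_ : snake (z + 1) = snake (z - 1)); last first.
    by rewrite -[LHS]snake_opp -[LHS]snake_period; congr snake; lia.
  rewrite nbrE; last by rewrite /range; nia.
  by case: Z.eqb_spec; case: Z.eqb_spec; case: Z.eqb_spec;
    rewrite /range in zB z'B; lia.
rewrite deg6 mul1n => ->.
have [z_0 z_N] : z <> 0 /\ z <> 2 * q * u.
  by split=> z0; have := proj2 (snake_degree3 zB); rewrite deg6 z0;
    [case/(_ (or_introl erefl))|case/(_ (or_intror erefl))].
rewrite !nbrE; [|rewrite /range in zB *; lia..].
by case: Z.eqb_spec; case: Z.eqb_spec; case: Z.eqb_spec; case: Z.eqb_spec;
  rewrite /range in zB z'B; lia.
Qed.

(** Position [n] of the spine lies in the row [Y = n]: on the line [X = 0] for even [n], and at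
    [X = -1] or [X = 1] alternately for odd [n]. The leg continues away from the line, [i] steps
    along the same row. *)
Definition tooth (n i : Z) : vertex P :=
  let j := n / 2 in
  if Z.even n then V (- j) (2 * j)
  else V (if Z.even j then - 1 - i - j else i - j) (2 * j + 1).

Let evenP j : (exists2 p, j = 2 * p & Z.even j = true) \/
              (exists2 p, j = 2 * p + 1 & Z.even j = false).
Proof.
have [[p pE]|[p pE]] := Z.Even_or_Odd j.
  by left; exists p => //; apply/Z.even_spec; exists p.
right; exists p => //; rewrite -Z.negb_odd (_ : Z.odd j = true) //.
by apply/Z.odd_spec; exists p.
Qed.

Lemma tooth_even j i : tooth (2 * j) i = V (- j) (2 * j).
Proof.
rewrite /tooth; case: (evenP (2 * j)) => [[p pE ->]|[p pE ->]]; last by lia.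
have -> : 2 * j / 2 = j by symmetry; apply: (Z.div_unique_pos _ _ _ 0); lia.
by [].
Qed.

Lemma tooth_odd j i :
  tooth (2 * j + 1) i = V (if Z.even j then - 1 - i - j else i - j) (2 * j + 1).
Proof.
rewrite /tooth; case: (evenP (2 * j + 1)) => [[p pE ->]|[p pE ->]]; first by lia.
have -> // : (2 * j + 1) / 2 = j.
by symmetry; apply: (Z.div_unique_pos _ _ _ 1); lia.
Qed.

Let parity n : (exists j, n = 2 * j) \/ (exists j, n = 2 * j + 1).
Proof. by have [[j ->]|[j ->]] := Z.Even_or_Odd n; [left | right]; exists j. Qed.

Lemma tooth_not_part n i a b :
  0 <= i <= 2 * q - 2 -> tooth n i = V a b -> ~ part a b.
Proof.
move=> iB; case: (parity n) => [[j ->]|[j ->]].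
  by rewrite tooth_even => /esym/part_vertex + pab => /(_ pab); not_part_lia.
rewrite tooth_odd => /esym/part_vertex + pab => /(_ pab).
by case: (evenP j) => [[p pE ->]|[p pE ->]]; not_part_lia.
Qed.

(** The half-turn about the origin reverses the spine; with [tooth_period] it folds the infinite
    comb onto [0 <= n <= 2 * u]. *)
Lemma tooth_opp n i : tooth (- n) i = tooth n i.
Proof.
case: (parity n) => [[j ->]|[j ->]].
  have -> : - (2 * j) = 2 * (- j) by lia.
  by rewrite !tooth_even -lattice_vertex_opp; congr (V _ _); lia.
have -> : - (2 * j + 1) = 2 * (- j - 1) + 1 by lia.
rewrite !tooth_odd -lattice_vertex_opp.
by case: (evenP j) => [[p pE ->]|[p pE ->]];
   case: (evenP (- j - 1)) => [[p' pE' ->]|[p' pE' ->]]; congr (V _ _); lia.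
Qed.

Lemma tooth_period n i : tooth (n + 4 * u) i = tooth n i.
Proof.
case: (parity n) => [[j ->]|[j ->]].
  have -> : 2 * j + 4 * u = 2 * (j + 2 * u) by lia.
  by rewrite !tooth_even; apply: (@lattice_vertex_period 0 1); lia.
have -> : 2 * j + 1 + 4 * u = 2 * (j + 2 * u) + 1 by lia.
rewrite !tooth_odd.
by case: (evenP j) => [[p pE ->]|[p pE ->]];
   case: (evenP (j + 2 * u)) => [[p' pE' ->]|[p' pE' ->]];
   apply: (@lattice_vertex_period 0 1); lia.
Qed.

Definition tooth_index n i :=
  0 <= n <= 2 * u /\ 0 <= i <= (if Z.even n then 0 else 2 * q - 2).

Lemma tooth_indexP n i : tooth_index n i ->
  (exists2 j, n = 2 * j & i = 0 /\ 0 <= j <= u) \/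
  (exists2 j, n = 2 * j + 1 & 0 <= i <= 2 * q - 2 /\ 0 <= j < u).
Proof.
case; case: (evenP n) => [[j -> ->]|[j -> ->]] nB iB; [left | right]; exists j;
  lia.
Qed.

Lemma tooth_surj a b : ~ part a b ->
  exists n i, tooth_index n i /\ V a b = tooth n i.
Proof.
move=> npab; have [m [r [XE rB]]] : exists m r,
    2 * a + b = 4 * q * m + r /\ 0 <= r < 4 * q.
  exists ((2 * a + b) / (4 * q)), ((2 * a + b) mod (4 * q)).
  by split; [apply: Z.div_mod | apply: Z.mod_pos_bound]; lia.
have [n [i [iB ->]]] : exists n i,
    0 <= i <= (if Z.even n then 0 else 2 * q - 2) /\ V a b = tooth n i.
  case: (evenP b) => [[w bE _]|[w bE _]].
    have r0 : r = 0.
      suff : ~ r <> 0 by lia.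
      move=> r_neq0; apply: npab; constructor 1; exists w => // m' m'E.
      have mm' : 4 * q * (m' - m) = r by lia.
      suff m'm : m' - m = 0 by rewrite m'm in mm'; lia.
      by apply: (@mul_between (4 * q)); lia.
    exists (2 * (w - 2 * h * m)), 0; rewrite tooth_even; split.
      by case: Z.even; lia.
    by apply: (@lattice_vertex_period m 0); lia.
  (* Rows with [Y = 1] modulo 4 are filled by the leg of the column to the right, the other odd rows
     by that of the column to the left. The one point at the far end of the leg belongs to
     [part]. *)
  case: (parity w) => [[v wE]|[v wE]].
    have X1 : r <> 1.
      by move=> X1; apply: npab; constructor 2; exists m, v; lia.
    have [i iE] : exists i, r - 4 * q = - (1 + 2 * i).
      by exists (- a - w + 2 * q * m + 2 * q - 1); lia.
    exists (2 * (2 * v - 2 * h * (m + 1)) + 1), i; rewrite tooth_odd; split.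
      by case: (evenP (2 * (2 * v - 2 * h * (m + 1)) + 1)) =>
        [[p pE ->]|[p pE ->]]; lia.
    case: (evenP (2 * v - 2 * h * (m + 1))) => [[p pE ->]|[p pE ->]]; last by lia.
    by apply: (@lattice_vertex_period (m + 1) 0); lia.
  have X1 : r <> 4 * q - 1.
    by move=> X1; apply: npab; constructor 3; exists (m + 1), (v + 1); lia.
  have [i iE] : exists i, r = 1 + 2 * i.
    by exists (a + w - 2 * q * m); lia.
  exists (2 * (2 * v + 1 - 2 * h * m) + 1), i; rewrite tooth_odd; split.
    by case: (evenP (2 * (2 * v + 1 - 2 * h * m) + 1)) =>
      [[p pE ->]|[p pE ->]]; lia.
  case: (evenP (2 * v + 1 - 2 * h * m)) => [[p pE ->]|[p pE ->]]; first by lia.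
  by apply: (@lattice_vertex_period m 0); lia.
have toothM l c : tooth (c + 4 * u * l) i = tooth c i.
  elim/Z.peano_ind: l => [|l IHl|l IHl]; first by congr tooth; lia.
    by rewrite -IHl -[RHS]tooth_period; congr tooth; lia.
  by rewrite -IHl -[LHS]tooth_period; congr tooth; lia.
have nE := Z.div_mod n (4 * u) ltac:(lia).
have nB := Z.mod_pos_bound n (4 * u) ltac:(lia).
set l := n / _ in nE; set c := n mod _ in nE nB.
have cP : Z.even c = Z.even n.
  by case: (evenP c) => [[p pE ->]|[p pE ->]]; case: (evenP n) =>
    [[p' pE' ->]|[p' pE' ->]]; lia.
have -> : tooth n i = tooth c i by rewrite nE Z.add_comm toothM.
rewrite -cP in iB.
have [le_c|lt_c] := Z.le_gt_cases c (2 * u); first by exists c, i; split=> //;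
  split; lia.
exists (4 * u - c), i; split.
  split; first by lia.
  by move: iB; case: (evenP c) => [[p pE ->]|[p pE ->]];
    case: (evenP (4 * u - c)) => [[p' pE' ->]|[p' pE' ->]]; lia.
by rewrite -tooth_opp -tooth_period; congr tooth; lia.
Qed.

Lemma tooth_inj n i n' i' : tooth_index n i -> tooth_index n' i' ->
  tooth n i = tooth n' i' -> n = n' /\ i = i'.
Proof.
case/tooth_indexP=> -[j -> [iB jB]]; case/tooth_indexP=> -[j' -> [i'B j'B]].
- rewrite !tooth_even => /lattice_vertex_inv[m [k [[mE kE]|[mE kE]]]].
    have m0 : m = 0 by apply: (@mul_between (4 * q)); lia.
    rewrite m0 in kE; have k0 : k = 0 by apply: (@mul_between (4 * u)); lia.
    by rewrite k0 in kE; lia.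
  have m0 : m = 0 by apply: (@mul_between (4 * q)); lia.
  rewrite m0 in kE.
  have kB : -1 < k /\ k < 2 by split; apply: (@mul_lt (2 * u)); lia.
  have [k0|k0] : k = 0 \/ k = 1 by lia.
    by rewrite k0 in kE; lia.
  by rewrite k0 in kE; lia.
- by rewrite tooth_even tooth_odd =>
  /lattice_vertex_inv[m [k [[mE kE]|[mE kE]]]]; lia.
- by rewrite tooth_even tooth_odd =>
  /lattice_vertex_inv[m [k [[mE kE]|[mE kE]]]]; lia.
rewrite !tooth_odd => /lattice_vertex_inv[m [k [[mE kE]|[mE kE]]]].
  have m0 : m = 0.
    apply: (@mul_between (4 * q)); first lia; move: mE.
    by case: (evenP j) => [[p pE ->]|[p pE ->]]; case: (evenP j') =>
      [[p' pE' ->]|[p' pE' ->]]; lia.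
  rewrite m0 in mE kE; have k0 : k = 0 by apply: (@mul_between (4 * u)); lia.
  have jj' : j = j' by rewrite k0 in kE; lia.
  rewrite jj' in mE *; split=> //.
  by move: mE; case: (Z.even j'); lia.
have m0 : m = 0.
  apply: (@mul_between (4 * q)); first lia; move: mE.
  by case: (evenP j) => [[p pE ->]|[p pE ->]]; case: (evenP j') =>
    [[p' pE' ->]|[p' pE' ->]]; lia.
rewrite m0 in kE.
suff : 0 < k /\ k < 1 by lia.
split; apply: (@mul_lt (4 * u)); move: kE; clear mE; lia.
Qed.

Lemma tooth_degree3 n i : tooth_index n i ->
  degree (tooth n i) = 3%N <-> n = 0 \/ n = 2 * u.
Proof.
case/tooth_indexP=> -[j -> [iB jB]].
  rewrite tooth_even; split=> [/lattice_degree3[m [k [mE kE]]]|j0].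
    have m0 : m = 0 by apply: (@mul_between (2 * q)); lia.
    rewrite m0 in kE.
    have kB : -1 < k /\ k < 2 by split; apply: (@mul_lt (2 * u)); lia.
    have [k0|k0] : k = 0 \/ k = 1 by lia.
      by rewrite k0 in kE; lia.
    by rewrite k0 in kE; lia.
  by apply/lattice_degree3; exists 0; case: j0 => j0; [exists 0 | exists 1]; lia.
rewrite tooth_odd; split=> [/lattice_degree3[m [k [mE kE]]]|]; last by lia.
by move: mE; case: (Z.even j); lia.
Qed.

Local Arguments Z.mul : simpl never.
Local Arguments Z.add : simpl never.
Local Arguments Z.sub : simpl never.
Local Arguments Z.eqb : simpl never.

(** At [n = 0] and [n = 2 * u] one entry has its index out of range; by [tooth_opp] and
    [tooth_period] it denotes the same vertex as the other entry. *)
Definition tooth_nbrs n i : seq (Z * Z) :=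
  if Z.even n then [:: (n + 1, 0); (n - 1, 0)]
  else (if i =? 0 then [:: (n + 1, 0); (n - 1, 0)] else [:: (n, i - 1)]) ++
       (if i <? 2 * q - 2 then [:: (n, i + 1)] else [::]).

Local Ltac part_lia p :=
  apply/part_range;
  [ lia
  | first
    [ constructor 1; exists (2 * p); [lia | split; lia]
    | constructor 1; exists (2 * p + 1); [lia | split; lia]
    | constructor 1; exists (2 * p + 2); [lia | split; lia]
    | constructor 2; exists p; [lia | first [constructor 1; lia |
      constructor 3; lia]]
    | constructor 3; exists p; [lia | first [constructor 1; lia |
      constructor 2; lia]]
    | constructor 3; exists (p + 1); [lia | first [constructor 1; lia |
      constructor 2; lia]]]].

Local Ltac nbrs_part p :=
  case=> [|[|[|[|[|[|//]]]]]] _;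
  first [by case/negP | move=> _; rewrite !hex_dE; part_lia p].

(** The list [ks] follows the order of [tooth_nbrs], and all remaining directions lead into [part],
    so that the comb has no further edges. *)
Lemma tooth_nbrsP n i : tooth_index n i -> exists a b ks,
  [/\ tooth n i = V a b, uniq ks && all (gtn 6%N) ks,
      [seq nbr k a b | k <- ks] = [seq tooth x.1 x.2 | x <- tooth_nbrs n i] &
      forall l, (l < 6)%N -> l \notin ks -> part (a + hex_dx l) (b + hex_dy l)].
Proof.
case/tooth_indexP=> -[j -> [iB jB]].
  exists (- j), (2 * j); rewrite /tooth_nbrs (_ : Z.even (2 * j) = true);
    last first.
    by apply/Z.even_spec; exists j.
  have -> : 2 * j - 1 = 2 * (j - 1) + 1 by lia.
  rewrite /= tooth_even !tooth_odd.
  case: (evenP j) => [[p pE ->]|[p pE ->]];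
  case: (evenP (j - 1)) => [[p' pE' ->]|[p' pE' ->]]; try lia.
    exists [:: 2%N; 5%N]; split=> //; last by nbrs_part p.
    by rewrite /= /hex_nbr !hex_dE; congr [:: V _ _; V _ _]; lia.
  exists [:: 1%N; 4%N]; split=> //; last by nbrs_part p.
  by rewrite /= /hex_nbr !hex_dE; congr [:: V _ _; V _ _]; lia.
exists (if Z.even j then - 1 - i - j else i - j), (2 * j + 1).
rewrite /tooth_nbrs (_ : Z.even (2 * j + 1) = false); last first.
  by case: (evenP (2 * j + 1)) => [[p pE _]|[]]; lia.
have -> : 2 * j + 1 + 1 = 2 * (j + 1) by lia.
have -> : 2 * j + 1 - 1 = 2 * j by lia.
rewrite tooth_odd; case: (evenP j) => [[p pE jE]|[p pE jE]]; rewrite jE;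
  case: Z.eqb_spec => i0; case: Z.ltb_spec => iq;
  rewrite /= ?tooth_even ?tooth_odd ?jE.
- exists [:: 1%N; 5%N; 3%N]; split=> //; last by nbrs_part p.
  by rewrite /= /hex_nbr !hex_dE; congr [:: V _ _; V _ _; V _ _]; lia.
- exists [:: 1%N; 5%N]; split=> //; last by nbrs_part p.
  by rewrite /= /hex_nbr !hex_dE; congr [:: V _ _; V _ _]; lia.
- exists [:: 0%N; 3%N]; split=> //; last by nbrs_part p.
  by rewrite /= /hex_nbr !hex_dE; congr [:: V _ _; V _ _]; lia.
- exists [:: 0%N]; split=> //; last by nbrs_part p.
  by rewrite /= /hex_nbr !hex_dE; congr [:: V _ _]; lia.
- exists [:: 2%N; 4%N; 0%N]; split=> //; last by nbrs_part p.
  by rewrite /= /hex_nbr !hex_dE; congr [:: V _ _; V _ _; V _ _]; lia.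
- exists [:: 2%N; 4%N]; split=> //; last by nbrs_part p.
  by rewrite /= /hex_nbr !hex_dE; congr [:: V _ _; V _ _]; lia.
- exists [:: 3%N; 0%N]; split=> //; last by nbrs_part p.
  by rewrite /= /hex_nbr !hex_dE; congr [:: V _ _; V _ _]; lia.
exists [:: 3%N]; split=> //; last by nbrs_part p.
by rewrite /= /hex_nbr !hex_dE; congr [:: V _ _]; lia.
Qed.

(** As for the snake, the two coinciding spine neighbours of an end of degree 3 account for a single
    edge. *)
Lemma tooth_edge n i n' i' : tooth_index n i -> tooth_index n' i' ->
  edge_mult (tooth n i) (tooth n' i') =
    ((n =? n') && ((i' =? i + 1) || (i =? i' + 1)) ||
     [&& i =? 0, i' =? 0 & (n' =? n + 1) || (n =? n' + 1)]) :> nat.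
Proof.
move=> ni ni'; have [a [b [ks [vE /andP[ks_uniq ks6] ksE nP]]]] := tooth_nbrsP ni.
have := hex_nbr_mult tri deg36 cone0 ks_uniq ks6 (i := a) (j := b) (y :=
  tooth n' i').
rewrite -(big_map (fun k => nbr k a b) xpredT (fun x => (x == tooth n' i') :
  nat)).
rewrite ksE big_map /= -vE => /(_ _)/wrap[].
  move=> l l6 lk /esym lE; apply: tooth_not_part lE (nP l l6 lk).
  by case/tooth_indexP: ni' => -[j' _]; lia.
have nbrE c k :
  tooth_index c k -> (tooth c k == tooth n' i') = (c =? n') && (k =? i').
  move=> ck; apply/eqP/andP=> [/(tooth_inj ck ni')[-> ->]|[/Z.eqb_eq-> /Z.eqb_eq-> //]].
  by rewrite !Z.eqb_refl.
have [n'B [i'B i'le]] := ni'.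
have i'n : n = n' -> i' <= if Z.even n then 0 else 2 * q - 2 by move=> ->.
have idx0 c : 0 <= c <= 2 * u -> tooth_index c 0.
  by split=> //; case: Z.even; lia.
have [[j nE [i0 jB]]|[j nE [iB jB]]] := tooth_indexP ni.
  have nev : Z.even n = true by rewrite nE; apply/Z.even_spec; exists j.
  rewrite nev in i'n; rewrite /tooth_nbrs nev !big_cons big_nil addn0 /= i0.
  have [/(tooth_degree3 ni) n0|deg6] := deg36 (tooth n i).
    rewrite -i0 (proj2 (tooth_degree3 ni) n0) i0.
    case: n0 => n0.
      rewrite (_ : tooth (n - 1) 0 = tooth (n + 1) 0); last first.
        by rewrite -[LHS]tooth_opp; congr tooth; lia.
      rewrite nbrE; last by apply: idx0; lia.
      by do ![case: Z.eqb_spec => ? //=; try (exfalso; lia)]; lia.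
    rewrite (_ : tooth (n + 1) 0 = tooth (n - 1) 0); last first.
      by rewrite -[LHS]tooth_opp -[LHS]tooth_period; congr tooth; lia.
    rewrite nbrE; last by apply: idx0; lia.
      by do ![case: Z.eqb_spec => ? //=; try (exfalso; lia)]; lia.
  have [n_0 n_u] : n <> 0 /\ n <> 2 * u.
    split=> n0; have := proj2 (tooth_degree3 ni); rewrite deg6 n0.
      by case/(_ (or_introl erefl)).
    by case/(_ (or_intror erefl)).
  rewrite -i0 deg6 i0 mul1n => ->; rewrite !nbrE; try (apply: idx0; lia).
  by do ![case: Z.eqb_spec => ? //=; try (exfalso; lia)]; lia.
have nodd : Z.even n = false by case: (evenP n) => [[p pE _]|[]] //; lia.
have deg6 : degree (tooth n i) = 6%N.
  by have [/(tooth_degree3 ni)|//] := deg36 (tooth n i); lia.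
have idx c : 0 <= c <= 2 * q - 2 -> tooth_index n c.
  by split; rewrite ?nodd //; lia.
rewrite nodd in i'n; rewrite deg6 mul1n /tooth_nbrs nodd => ->.
case: (Z.eqb_spec i 0) => i0; case: (Z.ltb_spec i (2 * q - 2)) => iq;
  rewrite /= ?big_cons big_nil ?addn0 /=;
  repeat (rewrite nbrE; last (first [apply: idx0; lia | apply: idx; lia]));
  by do ![case: Z.eqb_spec => ? //=; try (exfalso; lia)]; lia.
Qed.

(** * The two vertex sets as combs *)

Definition snake_set : {set vertex P} :=
  [set x in [seq snake (Z.of_nat k) | k <- iota 0 (Z.to_nat (2 * q * u)).+1]].

Lemma mem_snake_set i j : (V i j \in snake_set) <-> part i j.
Proof.
rewrite inE; split=> [/mapP[k _ /esym/snake_part //]|/snake_surj[z zB ->]].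
apply/mapP; exists (Z.to_nat z); last by congr snake; rewrite /range in zB; lia.
by rewrite mem_iota; rewrite /range in zB; lia.
Qed.

Lemma snake_set_even_caterpillar : is_even_caterpillar snake_set.
Proof.
pose f (k i : nat) := snake (Z.of_nat k).
have idxP n i : comb_index (Z.to_nat (2 * q * u)) 0 pred0 n i ->
    range (Z.of_nat n) /\ i = 0%N.
  by rewrite /comb_index /range /=; lia.
apply: (comb_even_caterpillar (f := f) (N := Z.to_nat (2 * q * u)) (k := 0%N)
          (leg := pred0)) => //.
- move=> n i n' i' /idxP[nB ->] /idxP[n'B ->] /(snake_inj nB n'B); lia.
- move=> n i n' i' /idxP[nB ->] /idxP[n'B ->]; rewrite /f snake_edge //.
  by congr nat_of_bool; rewrite /comb_edge; lia.
- move=> n i /idxP[nB _]; rewrite inE; apply/mapP; exists n => //.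
  by rewrite mem_iota; rewrite /range in nB; lia.
move=> x; rewrite inE => /mapP[n]; rewrite mem_iota => nB ->.
by exists n, 0%N; split=> //; rewrite /comb_index /=; lia.
Qed.

(** Legs hang at the odd positions of the spine and have the even order [2 * q - 2]; for [q = 1] the
    comb is a path. *)
Lemma setC_snake_set_even_caterpillar : is_even_caterpillar (~: snake_set).
Proof.
pose f (n i : nat) := tooth (Z.of_nat n) (Z.of_nat i).
have idxP n i : comb_index (Z.to_nat (2 * u)) (Z.to_nat (2 * q - 2)) odd n i <->
    tooth_index (Z.of_nat n) (Z.of_nat i).
  have oddE : odd n = ~~ Z.even (Z.of_nat n).
    by case: (evenP (Z.of_nat n)) => [[p pE ->]|[p pE ->]]; lia.
  by rewrite /comb_index /tooth_index oddE; case: Z.even => /=; lia.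
apply: (comb_even_caterpillar (f := f) (N := Z.to_nat (2 * u))
          (k := Z.to_nat (2 * q - 2)) (leg := odd)); last by lia.
- by move=> n i n' i' /idxP ni /idxP ni' /(tooth_inj ni ni'); lia.
- move=> n i n' i' /idxP ni /idxP ni'; rewrite /f tooth_edge //.
  by congr nat_of_bool; rewrite /comb_edge; lia.
- move=> n i /idxP ni; rewrite inE; apply/negP.
  have [a [b abE]] := hex_vertex_surj tri deg36 d0 (f n i).
  rewrite abE => /mem_snake_set; apply: tooth_not_part abE.
  by case/tooth_indexP: ni => -[j' _]; lia.
move=> x; rewrite inE; have [a [b ->]] := hex_vertex_surj tri deg36 d0 x.
move/negP=> nab; have [|n [i [ni ->]]] := @tooth_surj a b.
  by move/mem_snake_set.
have [nB [iB _]] := ni.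
exists (Z.to_nat n), (Z.to_nat i).
have [nE iE] : Z.of_nat (Z.to_nat n) = n /\ Z.of_nat (Z.to_nat i) = i by lia.
by rewrite idxP /f nE iE.
Qed.

End Partition.

Theorem theorem6p1 (P : plane_graph) (n : nat)
    (hP : in_class_P P) (horder : #|vertex P| = (2 * n)%N) (hn : odd n) :
  exists A B : {set vertex P},
    [/\ A :|: B = [set: vertex P], [disjoint A & B],
        is_even_caterpillar A & is_even_caterpillar B].
Proof.
have [_ tri deg36] := hP.
have [d0 cone0 rows] := even_rows tri deg36 horder hn.
have [u [q [h [u0 q0 periodE]]]] := hex_period_basis tri deg36 cone0 rows.
exists (snake_set d0 u q h), (~: snake_set d0 u q h); split.
- exact: setUCr.
- by rewrite -setI_eq0 setICr.
- exact: snake_set_even_caterpillar.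
exact: setC_snake_set_even_caterpillar.
Qed.
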